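(* Let $R$ be an $SL$-finite Noetherian commutative ring, and let $V$ be a finitely generated $VIC(\mathbb{Z})$-module over $R$ which is pointwise finitely generated over $R$. Then any $VIC(\mathbb{Z})$-submodule of $V$ is finitely generated.
   Context: A commutative ring $R$ is called $SL$-finite if for every $n>2$, every representation of $SL_n(\mathbb{Z})$ over $R$ whose underlying $R$-module is finitely generated is of finite type, i.e. factors through a finite quotient of $SL_n(\mathbb{Z})$. $VIC(\mathbb{Z})$ is the category whose objects are the free $\mathbb{Z}$-modules of finite rank at least $3$ and whose morphisms $M \to N$ are split injections, i.e. pairs $(f,g)$ of linear maps $f: M\to N$, $g: N \to M$ with $g\circ f = \mathrm{id}_M$. A $VIC(\mathbb{Z})$-module over $R$ is a functor $V$ from $VIC(\mathbb{Z})$ to $R$-modules; write $V_n = V(\mathbb{Z}^n)$ ($n\ge3$). A submodule is a subfunctor (of $R$-modules). $V$ is finitely generated if there are finitely many elements $v_j \in V(X_j)$ such that every element of every $V(X)$ is an $R$-linear combination of images of the $v_j$ under maps induced by morphisms $X_j \to X$. $V$ is pointwise finitely generated over $R$ if every $V_n$ is a finitely generated $R$-module. *)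

(* Defs.v *)
From HB Require Import structures.
From mathcomp Require Import all_boot all_order all_algebra all_fingroup.

Set Implicit Arguments.
Unset Strict Implicit.
Unset Printing Implicit Defensive.

Import GRing.Theory.
Local Open Scope ring_scope.

Section Modules.
Variables (R : comPzRingType) (M : lmodType R).

(* Submodules are arbitrary, not necessarily decidable, predicates; hence
   Prop-valued rather than the library's boolean submodClosed structures. *)
Definition is_submodule (P : M -> Prop) : Prop :=
  P 0 /\ forall a x y, P x -> P y -> P (a *: x + y).

Definition fg_submodule (P : M -> Prop) : Prop :=
  exists (k : nat) (e : 'I_k -> M), (forall i, P (e i)) /\
    forall x, P x -> exists c : 'I_k -> R, x = \sum_(i < k) c i *: e i.

Definition fg_module : Prop := fg_submodule (fun _ => True).

End Modules.

Definition noetherian (R : comPzRingType) : Prop :=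
  forall I : R^o -> Prop, is_submodule I -> fg_submodule I.

Record SLZ (n : nat) := MkSLZ { slmx :> 'M[int]_n; _ : \det slmx == 1 }.

HB.instance Definition _ n := [isSub for @slmx n].
HB.instance Definition _ n := [Choice of SLZ n by <:].

Section SLZGroup.
Variable n : nat.

Fact slz_one_subproof : \det (1%:M : 'M[int]_n) == 1.
Proof. by rewrite det1. Qed.

Fact slz_mul_subproof (A B : SLZ n) : \det (A *m B) == 1.
Proof. by case: A B => [A /= /eqP hA] [B /= /eqP hB]; rewrite det_mulmx hA hB. Qed.

Fact slz_inv_subproof (A : SLZ n) : \det (invmx A) == 1.
Proof. by case: A => [A /= /eqP hA]; rewrite det_inv hA invr1. Qed.

Definition slz_one : SLZ n := MkSLZ slz_one_subproof.
Definition slz_mul (A B : SLZ n) : SLZ n := MkSLZ (slz_mul_subproof A B).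
Definition slz_inv (A : SLZ n) : SLZ n := MkSLZ (slz_inv_subproof A).

Fact slz_unitmx (A : SLZ n) : (A : 'M[int]_n) \in unitmx.
Proof. by case: A => [A /= /eqP hA]; rewrite unitmxE hA unitr1. Qed.

Fact slz_mulA : associative slz_mul.
Proof. by move=> A B C; apply: val_inj; rewrite /= mulmxA. Qed.

Fact slz_mul1 : left_id slz_one slz_mul.
Proof. by move=> A; apply: val_inj; rewrite /= mul1mx. Qed.

Fact slz_mulr1 : right_id slz_one slz_mul.
Proof. by move=> A; apply: val_inj; rewrite /= mulmx1. Qed.

Fact slz_mulV : left_inverse slz_one slz_inv slz_mul.
Proof. by move=> A; apply: val_inj; rewrite /= mulVmx ?slz_unitmx. Qed.

Fact slz_mulrV : right_inverse slz_one slz_inv slz_mul.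
Proof. by move=> A; apply: val_inj; rewrite /= mulmxV ?slz_unitmx. Qed.

HB.instance Definition _ := isGroup.Build (SLZ n)
  slz_mulA slz_mul1 slz_mulr1 slz_mulV slz_mulrV.

End SLZGroup.

Record representation (G : groupType) (R : comPzRingType) (M : lmodType R) :=
  Representation {
    rep_act :> G -> {linear M -> M};
    rep_act1 : forall x, rep_act 1%g x = x;
    rep_actM : forall g h x, rep_act (g * h)%g x = rep_act g (rep_act h x)
  }.

Definition of_finite_type (G : groupType) (R : comPzRingType) (M : lmodType R)
    (rho : representation G M) : Prop :=
  exists (Q : finGroupType) (p : {multiplicative G -> Q})
         (rhoQ : representation Q M),
    (forall q, exists g, p g = q) /\ (forall g x, rho g x = rhoQ (p g) x).

Definition SL_finite (R : comPzRingType) : Prop :=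
  forall n : nat, (2 < n)%N ->
  forall (M : lmodType R) (rho : representation (SLZ n) M),
    fg_module M -> of_finite_type rho.

(* A vectType over int is a free Z-module of finite rank dim (it also
   records a basis, which the morphisms below ignore). *)
Record VICobj := MkVICobj {
  vic_carrier :> vectType int;
  vic_rank : (2 < dim vic_carrier)%N
}.

Record VIChom (X Y : VICobj) := MkVIChom {
  vic_inj : 'Hom(vic_carrier X, vic_carrier Y);
  vic_ret : 'Hom(vic_carrier Y, vic_carrier X);
  vic_retK : (vic_ret \o vic_inj = \1)%VF
}.

Fact vic_id_subproof (X : VICobj) :
  (\1 \o \1 = \1 :> 'End(vic_carrier X))%VF.
Proof. exact: comp_lfun1l. Qed.

Definition vic_id (X : VICobj) : VIChom X X := MkVIChom (vic_id_subproof X).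

Fact vic_comp_subproof (X Y Z : VICobj) (b : VIChom Y Z) (a : VIChom X Y) :
  ((vic_ret a \o vic_ret b) \o (vic_inj b \o vic_inj a) = \1)%VF.
Proof.
rewrite comp_lfunA -(comp_lfunA (vic_ret a)) vic_retK.
by rewrite comp_lfun1r vic_retK.
Qed.

Definition vic_comp (X Y Z : VICobj) (b : VIChom Y Z) (a : VIChom X Y) :
  VIChom X Z := MkVIChom (vic_comp_subproof b a).

Fact vic_std_subproof (n : nat) :
  (2 < n)%N -> (2 < dim ('rV[int]_n : vectType int))%N.
Proof. by rewrite -[dim _]/(1 * n)%N mul1n. Qed.

Definition vic_std (n : nat) (hn : (2 < n)%N) : VICobj :=
  MkVICobj (vic_std_subproof hn).

Record VICmodule (R : comPzRingType) := MkVICmodule {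
  vic_obj :> VICobj -> lmodType R;
  vic_map : forall X Y : VICobj, VIChom X Y -> {linear vic_obj X -> vic_obj Y};
  vic_map_id : forall (X : VICobj) (x : vic_obj X), vic_map (vic_id X) x = x;
  vic_map_comp : forall (X Y Z : VICobj) (b : VIChom Y Z) (a : VIChom X Y)
      (x : vic_obj X), vic_map (vic_comp b a) x = vic_map b (vic_map a x)
}.

Section VICModules.
Variables (R : comPzRingType) (V : VICmodule R).

Record VICsubmodule := MkVICsubmodule {
  vsub_mem :> forall X : VICobj, V X -> Prop;
  vsub_submodule : forall X : VICobj, is_submodule (@vsub_mem X);
  vsub_map : forall (X Y : VICobj) (a : VIChom X Y) (x : V X),
    vsub_mem x -> vsub_mem (vic_map V a x)
}.

Definition vic_full : VICsubmodule :=
  @MkVICsubmodule (fun _ _ => True)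
    (fun _ => conj I (fun _ _ _ _ _ => I)) (fun _ _ _ _ _ => I).

(* y is an R-linear combination of images of the v j; the same v j may occur
   several times in s, with different morphisms. *)
Definition vic_combination (k : nat) (X : 'I_k -> VICobj)
    (v : forall j, V (X j)) (Y : VICobj) (y : V Y) : Prop :=
  exists s : seq {j : 'I_k & (R * VIChom (X j) Y)%type},
    y = \sum_(t <- s) (tagged t).1 *: vic_map V (tagged t).2 (v (tag t)).

Definition vsub_finitely_generated (U : VICsubmodule) : Prop :=
  exists (k : nat) (X : 'I_k -> VICobj) (v : forall j, V (X j)),
    (forall j, U (X j) (v j)) /\
    forall (Y : VICobj) (y : V Y), U Y y -> vic_combination v y.

Definition vic_finitely_generated : Prop := vsub_finitely_generated vic_full.

Definition vic_pointwise_fg : Prop :=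
  forall (n : nat) (hn : (2 < n)%N), fg_module (V (vic_std hn)).

End VICModules.

(* Main.v *)
Require Import Defs.
From mathcomp Require Import all_boot all_order all_algebra all_fingroup.
From Stdlib Require Import Classical ClassicalEpsilon.

Set Implicit Arguments.
Unset Strict Implicit.
Unset Printing Implicit Defensive.

Import GRing.Theory VectorInternalTheory.
Local Open Scope ring_scope.

(** Why the theorem holds.

    Write a morphism X -> Z as a split pair of integer matrices (A, B) with
    A B = 1, rows being vectors; composition multiplies the A and the B.  In
    one rank there is nothing to do, as a submodule of a finitely generated
    module over a Noetherian ring is finitely generated.  The point is to
    control all large ranks at once, in two stages.

    Stage 1: for v in V X, the vector V(f) v depends on f only modulo some
    N > 0, uniformly in the target.  If W U = 0 then (1 + U W)^N = 1 + N U W.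
    Over an SL-finite ring the action of SL on the rank 3 dim X term goes
    through a finite group, so with N its order every transvection 1 + N U W
    acts trivially there ([transv_act_trivially]).  In a larger rank, Smith
    normal forms move U, W and the image of X simultaneously into a summand of
    rank 3 dim X ([split_pair_transvection_factor]), so the same N works for
    vectors coming from X.  Finally any two split pairs congruent modulo N
    differ by three such transvections
    ([congruent_split_pair_transvections]): as in the stable range of algebraic
    K-theory, 3 dim X coordinates leave enough room for elementary moves.

    Stage 2: a morphism from a fixed X modulo N is a word over a finite
    alphabet, the letter at k being the k-th column of A and the k-th row of
    B modulo N, and V is spanned in large rank by the images of finitely many
    vectors under such words.  This is the setting of a Hilbert basis
    argument.  The words are ordered by [key]; a word w' obtained from w by
    repeating letters in a suitable way ([stretch]) is the image of w under a
    morphism that also maps every word smaller than w to a word smaller than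
    w' ([key_stretch]); and by Higman's lemma every infinite sequence of words
    has an infinite subsequence each of whose members is a stretch of all
    earlier ones ([stretch_wqo]).  Noetherianity of R applied to leading
    coefficients along such a subsequence then bounds the number of generators
    of a submodule ([groebner_generation]).  The same argument, with
    isomorphisms in place of stretches, settles each of the finitely many
    small ranks. *)

(** * Split pairs of integer matrices *)

Lemma mul_pid_mx_min m n p r s t : (minn n (minn s t) = r)%N ->
  (pid_mx s : 'M[int]_(m, n)) *m (pid_mx t : 'M_(n, p)) = pid_mx r.
Proof. by move=> <-; apply: mul_pid_mx. Qed.

Lemma pid_mul_rows n m l (M : 'M[int]_(n, m)) :
  (forall (i : 'I_n) j, (l <= i)%N -> M i j = 0) -> (pid_mx l : 'M_n) *m M = M.
Proof.
move=> M0; apply/matrixP=> i j; rewrite mxE (bigD1 i) //= big1 ?addr0.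
  by rewrite mxE eqxx /=; case: ltnP => [_|/M0->]; rewrite ?mul1r ?mulr0.
by move=> k /negPf ki; rewrite mxE eq_sym -val_eqE /= in ki *; rewrite ki mul0r.
Qed.

Lemma pid_mul_cols n m l (M : 'M[int]_(m, n)) :
  (forall i (j : 'I_n), (l <= j)%N -> M i j = 0) -> M *m (pid_mx l : 'M_n) = M.
Proof.
move=> M0; apply: trmx_inj; rewrite trmx_mul tr_pid_mx pid_mul_rows //.
by move=> i j /M0 M0j; rewrite mxE.
Qed.

(** A Smith form of a wide matrix is square up to a zero block on the right;
    this is how free coordinates are found below. *)
Lemma smith_row m k (M : 'M[int]_(m, m + k)) :
  exists2 L : 'M_m, L \in unitmx & exists2 R : 'M_(m + k), R \in unitmx &
  exists D : 'M_m, M = L *m row_mx D 0 *m R.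
Proof.
have [L uL [R uR [d _ ->]]] := int_Smith_normal_form M.
exists L => //; exists R => //.
exists (\matrix_(i, j) (d`_i *+ (i == j :> nat))); congr (_ *m _ *m _).
apply/matrixP=> i j; rewrite !mxE; case: splitP => k' jk; rewrite mxE jk //.
by rewrite ltn_eqF // (leq_trans (ltn_ord i)) ?leq_addr.
Qed.

(** The general linear group is transitive on split pairs: the Smith form of
    A is a unit because A has a right inverse, so A becomes (1 0), and a shear
    then clears the lower part of B without moving A. *)
Lemma split_pair_standard m n (A : 'M[int]_(m, n)) (B : 'M_(n, m)) :
  (m <= n)%N -> A *m B = 1%:M ->
  exists2 g : 'M_n, g \in unitmx &
    A = pid_mx m *m g /\ B = invmx g *m pid_mx m.
Proof.
move=> /subnKC; move: (n - m)%N => k nE; case: n / nE in A B * => AB.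
have [L uL [R uR [D DE]]] := smith_row A.
have uLD : L *m D \in unitmx.
  suff: L *m D *m usubmx (R *m B) = 1%:M by case/mulmx1_unit.
  rewrite -AB DE -[RHS]mulmxA -{2}(vsubmxK (R *m B)) -!mulmxA.
  by rewrite mul_row_col mul0mx addr0.
pose g0 := block_mx (L *m D) 0 0 1%:M *m R.
have ug0 : g0 \in unitmx.
  by rewrite unitmx_mul uR andbT unitmxE det_ublock det1 mulr1 -unitmxE.
have Ag0 : A = row_mx 1%:M 0 *m g0.
  by rewrite mulmxA mul_row_block !mul1mx !mul0mx !addr0 DE mul_mx_row mulmx0.
pose c := dsubmx (g0 *m B).
have g0B : g0 *m B = col_mx 1%:M c.
  rewrite -[LHS]vsubmxK -/c; congr col_mx.
  have := AB; rewrite Ag0 -(mulmxA _ g0 B) -{1}(vsubmxK (g0 *m B)).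
  by rewrite mul_row_col mul1mx mul0mx addr0.
pose s : 'M[int]_(m + k) := block_mx 1%:M 0 (- c) 1%:M.
have us : s \in unitmx by rewrite unitmxE det_lblock !det1 mulr1.
exists (s *m g0); first by rewrite unitmx_mul us.
split.
  rewrite pid_mx_row mulmxA mul_row_block !mul1mx !mul0mx !addr0.
  exact: Ag0.
have ug : s *m g0 \in unitmx by rewrite unitmx_mul us.
rewrite -[LHS](mulKmx ug); congr (_ *m _).
rewrite -mulmxA g0B mul_block_col pid_mx_col !mul1mx mul0mx addr0.
by rewrite mulmx1 addNr.
Qed.

(** Only 3m coordinates matter for a split pair together with U and W: put the
    pair in standard form, use a Smith form of the lower part of U to confine
    U to the first 2m coordinates, and a Smith form of what remains of W,
    acting on the last n - 2m coordinates, to confine W to the first 3m. *)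
Lemma split_pair_transvection_factor l m n (A : 'M[int]_(m, n))
    (B U : 'M_(n, m)) (W : 'M_(m, n)) :
  l = (m + (m + m))%N -> (l <= n)%N -> A *m B = 1%:M -> W *m U = 0 ->
  exists (P : 'M_(l, n)) (Q : 'M_(n, l))
    (A0 W0 : 'M_(m, l)) (B0 U0 : 'M_(l, m)),
  [/\ P *m Q = 1%:M, A0 *m B0 = 1%:M, W0 *m U0 = 0 &
   [/\ A = A0 *m P, B = Q *m B0, U = Q *m U0 & W = W0 *m P]].
Proof.
move=> lE; rewrite {}lE {l} => len AB WU.
have lmn : (m <= n)%N by apply: leq_trans len; rewrite leq_addr.
have [g0 ug0 [Ag Bg]] := split_pair_standard lmn AB.
(* h need only straighten U and W while fixing the standard pair. *)
suff [h uh [Ah Bh [Uh Wh]]] : exists2 h : 'M[int]_n, h \in unitmx &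
    [/\ pid_mx m = (pid_mx m : 'M_(m, n)) *m h,
       pid_mx m = invmx h *m (pid_mx m : 'M_(n, m)) &
       (forall (i : 'I_n) j, (m + (m + m) <= i)%N ->
          (h *m (g0 *m U)) i j = 0) /\
       (forall i (j : 'I_n), (m + (m + m) <= j)%N ->
          (W *m invmx g0 *m invmx h) i j = 0)].
  set l := (m + (m + m))%N in len Uh Wh *.
  pose g := h *m g0.
  have ug : g \in unitmx by rewrite unitmx_mul uh.
  have gV : invmx g = invmx g0 *m invmx h.
    rewrite -[RHS](mulKmx ug) -(mulmxA h) (mulKVmx ug0) mulmxV //.
    by rewrite mulmx1.
  pose P : 'M_(l, n) := pid_mx l *m g.
  pose Q : 'M_(n, l) := invmx g *m pid_mx l.
  have le_ml : (m <= l)%N by apply: leq_addr.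
  have lml : minn l (minn m l) = m.
    by rewrite (minn_idPl le_ml) (minn_idPr le_ml).
  have llm : minn l (minn l m) = m by rewrite !(minn_idPr le_ml).
  have lll : minn l (minn l l) = l by rewrite !minnn.
  have nll : minn n (minn l l) = l by rewrite minnn; apply/minn_idPr.
  have lmm : minn l (minn m m) = m by rewrite minnn; apply/minn_idPr.
  have AE : A = pid_mx m *m P.
    by rewrite mulmxA (mul_pid_mx_min _ _ lml) [LHS]Ag {1}Ah -mulmxA.
  have BE : B = Q *m pid_mx m.
    by rewrite -mulmxA (mul_pid_mx_min _ _ llm) [LHS]Bg {1}Bh mulmxA gV.
  have UE : U = Q *m (pid_mx l *m (g *m U)).
    rewrite /Q -!mulmxA [pid_mx l *m (pid_mx l *m _)]mulmxA.
    rewrite (mul_pid_mx_min _ _ lll) pid_mul_rows ?(mulmxA h) ?mulKmx // => i j.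
    by rewrite -mulmxA; apply: Uh.
  have WE : W = (W *m invmx g *m pid_mx l) *m P.
    rewrite /P !mulmxA -(mulmxA _ (pid_mx l) (pid_mx l)).
    rewrite (mul_pid_mx_min _ _ lll) pid_mul_cols => [|i j].
      by rewrite -(mulmxA _ h) mulmxKV.
    by rewrite gV mulmxA; apply: Wh.
  have PQ : P *m Q = 1%:M.
    by rewrite mulmxA mulmxK // (mul_pid_mx_min _ _ nll) pid_mx_1.
  exists P, Q, (pid_mx m), (W *m invmx g *m pid_mx l), (pid_mx m).
  exists (pid_mx l *m (g *m U)); split=> //.
    by rewrite (mul_pid_mx_min _ _ lmm) pid_mx_1.
  move: WU; rewrite {1}WE {1}UE -(mulmxA _ P) (mulmxA P Q) PQ mul1mx.
  by [].
move: {Ag Bg WU} (g0 *m U) (W *m invmx g0) => {}U {}W.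
move: len; rewrite addnA => /subnKC; move: (n - _)%N => r.
rewrite -!addnA => nE.
case: n / nE {lmn g0 ug0} in A B AB U W *.
have [L uL [R uR [D UE]]] := smith_row (dsubmx U)^T.
have [L' uL' [R' uR' [D' WE]]] := smith_row (rsubmx (rsubmx W *m R^T)).
(* R^T clears U below row 2m; R' then clears W beyond column 3m, and leaves U
   alone because it moves only coordinates where U already vanishes. *)
pose k : 'M_(m + (m + r)) := block_mx 1%:M 0 0 R' *m invmx R^T.
have uk : k \in unitmx.
  rewrite unitmx_mul unitmx_inv unitmx_tr uR andbT unitmxE det_ublock det1.
  by rewrite mul1r -unitmxE.
pose h : 'M_(m + (m + (m + r))) := block_mx 1%:M 0 0 k.
have uh : h \in unitmx by rewrite unitmxE det_ublock det1 mul1r -unitmxE.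
have hV : invmx h = block_mx 1%:M 0 0 (invmx k).
  rewrite -[RHS](mulKmx uh) mulmx_block !mul1mx !mul0mx !mulmx0 !addr0 add0r.
  by rewrite mulmxV // -scalar_mx_block mulmx1.
exists h => //; split.
- by rewrite pid_mx_row mul_row_block !mul1mx !mul0mx !addr0.
- by rewrite hV pid_mx_col mul_block_col !mulmx1 !mul0mx !mulmx0 !addr0.
split.
- move=> i j; rewrite -[U]vsubmxK mul_block_col !mul0mx add0r mxE.
  case: splitP => i' -> //.
    by rewrite leqNgt (leq_trans (ltn_ord _)) ?leq_addr.
  rewrite leq_add2l => le_i.
  have -> : k *m dsubmx U = col_mx (D^T *m L^T) 0.
    rewrite -[dsubmx U]trmxK UE !trmx_mul /k -mulmxA mulKmx ?unitmx_tr //.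
    rewrite tr_row_mx !mul_col_mx !mul_row_col !mul1mx trmx0 !mul0mx mulmx0.
    by rewrite !addr0.
  rewrite mxE; case: splitP => i'' i''E; last by rewrite mxE.
  by move: le_i; rewrite i''E leqNgt (leq_trans (ltn_ord _)) ?leq_addr.
move=> i j; rewrite hV -[W]hsubmxK mul_row_block !mulmx0 add0r mxE.
case: splitP => j' -> //.
  by rewrite leqNgt (leq_trans (ltn_ord _)) ?leq_addr.
rewrite leq_add2l => le_j.
have -> : rsubmx W *m invmx k =
    row_mx (lsubmx (rsubmx W *m R^T)) (L' *m row_mx D' 0).
  apply: (canLR (mulmxK uk)); rewrite mulmxA mul_row_block !mulmx0 mulmx1.
  by rewrite addr0 add0r -WE hsubmxK mulmxK // unitmx_tr.
rewrite mxE; case: splitP => j'' j''E.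
  by move: le_j; rewrite j''E leqNgt (leq_trans (ltn_ord _)) ?leq_addr.
rewrite mul_mx_row mulmx0 mxE; case: splitP => j3 j3E; last by rewrite mxE.
by move: le_j; rewrite j''E j3E leq_add2l leqNgt ltn_ord.
Qed.

(** * Transvections *)

Definition transv m n (N : int) (U : 'M[int]_(n, m)) (W : 'M_(m, n)) : 'M_n :=
  1%:M + N *: (U *m W).

Lemma mul_transv m p n N (A : 'M_(p, n)) (U : 'M[int]_(n, m)) (W : 'M_(m, n)) :
  A *m transv N U W = A + N *: (A *m U *m W).
Proof. by rewrite mulmxDr mulmx1 -scalemxAr mulmxA. Qed.

Lemma transv_mul m p n N (A : 'M_(n, p)) (U : 'M[int]_(n, m)) (W : 'M_(m, n)) :
  transv N U W *m A = A + N *: (U *m (W *m A)).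
Proof. by rewrite mulmxDl mul1mx -scalemxAl mulmxA. Qed.

Lemma transvD m n N N' (U : 'M[int]_(n, m)) (W : 'M_(m, n)) : W *m U = 0 ->
  transv N U W *m transv N' U W = transv (N + N') U W.
Proof.
move=> WU; rewrite mul_transv transv_mul WU mulmx0 scaler0 addr0.
by rewrite /transv scalerDl addrA.
Qed.

Lemma transv0 m n (U : 'M[int]_(n, m)) (W : 'M_(m, n)) : transv 0 U W = 1%:M.
Proof. by rewrite /transv scale0r addr0. Qed.

Lemma transvV m n N (U : 'M[int]_(n, m)) (W : 'M_(m, n)) : W *m U = 0 ->
  transv N U W *m transv (- N) U W = 1%:M.
Proof. by move=> WU; rewrite transvD // subrr transv0. Qed.

(** Both sides of det(1 + N U W) = det(1 + N W U) are determinants of the same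
    bordered matrix, factored in two ways. *)
Lemma det_transv m n N (U : 'M[int]_(n, m)) (W : 'M_(m, n)) : W *m U = 0 ->
  \det (transv N U W) = 1.
Proof.
move=> WU; pose T := block_mx 1%:M (- (N *: U)) W 1%:M : 'M[int]_(n + m).
have T1 : T = block_mx 1%:M 0 W 1%:M *m block_mx 1%:M (- (N *: U)) 0 1%:M.
  rewrite mulmx_block !(mul1mx, mul0mx, mulmx1, mulmx0, addr0).
  by rewrite mulmxN -scalemxAr WU scaler0 oppr0 add0r.
have T2 : T = block_mx 1%:M (- (N *: U)) 0 1%:M
    *m block_mx (transv N U W) 0 W 1%:M.
  rewrite mulmx_block !(mul1mx, mul0mx, mulmx1, mulmx0, add0r).
  by rewrite mulNmx -scalemxAl addrK.
have := congr1 (@determinant _ _) T1.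
by rewrite {1}T2 !det_mulmx !det_lblock !det_ublock !det1 !mul1r !mulr1.
Qed.

(** Write A = (1 + N a, N b).  If b has a right inverse Y, the single
    transvection with U = (1, - Y a) and W = - (a b) already takes A to (1 0):
    A U = 1, so A changes by N W.  In general b is first replaced by
    b + (1 + N a) w, where w lives in coordinates that a Smith form of b leaves
    free; A B = 1 says that (b, 1 + N a) has a right inverse, hence so has the
    new b.  Once A is (1 0), a last transvection fixing A corrects B. *)
Lemma congruent_split_pair_transvections m n (N : int) (A A1 : 'M[int]_(m, n))
    (B B1 : 'M_(n, m)) :
  (m + (m + m) <= n)%N -> A *m B = 1%:M ->
  A = pid_mx m + N *: A1 -> B = pid_mx m + N *: B1 ->
  exists (U1 U2 U3 : 'M[int]_(n, m)) (W1 W2 W3 : 'M[int]_(m, n)),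
   [/\ W1 *m U1 = 0, W2 *m U2 = 0, W3 *m U3 = 0,
    A *m transv N U1 W1 *m transv N U2 W2 *m transv N U3 W3 = pid_mx m &
    transv (- N) U3 W3 *m (transv (- N) U2 W2 *m (transv (- N) U1 W1 *m B))
      = pid_mx m].
Proof.
move=> /subnKC; move: (n - _)%N => r; rewrite -!addnA => nE.
case: n / nE in A B A1 B1 * => AB; rewrite pid_mx_row pid_mx_col => AE BE.
set k := (m + (m + r))%N in A B A1 B1 AB AE BE *.
pose a := lsubmx A1; pose b := rsubmx A1.
have {}AE : A = row_mx (1%:M + N *: a) (N *: b).
  rewrite AE -{1}[A1]hsubmxK scale_row_mx add_row_mx add0r.
  by [].
have [L uL [R uR [D bE]]] := smith_row b.
pose w : 'M_(m, k) := row_mx 0 (row_mx 1%:M 0) *m R.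
pose b2 := b + (1%:M + N *: a) *m w.
have b2E : b2 = row_mx (L *m D) (row_mx (1%:M + N *: a) 0) *m R.
  rewrite /b2 bE /w mulmxA -mulmxDl !mul_mx_row !mulmx0 mulmx1 add_row_mx.
  by rewrite addr0 add0r.
(* A right inverse of b2, read off from A B = 1. *)
pose Y := invmx R *m col_mx (N *: usubmx (R *m dsubmx B)) (col_mx (usubmx B) 0).
have b2Y : b2 *m Y = 1%:M.
  rewrite b2E -mulmxA mulKVmx // !mul_row_col mul0mx addr0 -[RHS]AB AE.
  rewrite -{3}[B]vsubmxK mul_row_col addrC; congr (_ + _).
  rewrite bE -scalemxAl -scalemxAr -!mulmxA; congr (_ *: (_ *m _)).
  by rewrite -{2}(vsubmxK (R *m _)) mul_row_col mul0mx addr0.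
pose U1 : 'M[int]_(m + k, m) := col_mx 1%:M 0.
pose W1 : 'M[int]_(m, m + k) := row_mx 0 w.
pose U2 : 'M[int]_(m + k, m) := col_mx 1%:M (- (Y *m a)).
pose W2 : 'M[int]_(m, m + k) := - row_mx a b2.
have WU1 : W1 *m U1 = 0 by rewrite mul_row_col mul0mx mulmx0 addr0.
have WU2 : W2 *m U2 = 0.
  by rewrite mulNmx mul_row_col mulmx1 mulmxN mulmxA b2Y mul1mx subrr oppr0.
have A1E : A *m transv N U1 W1 = row_mx (1%:M + N *: a) (N *: b2).
  rewrite mul_transv AE mul_row_col mulmx1 mulmx0 addr0 mul_mx_row mulmx0.
  by rewrite scale_row_mx scaler0 add_row_mx addr0 /b2 scalerDr.
have A2E : A *m transv N U1 W1 *m transv N U2 W2 = row_mx 1%:M 0.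
  have -> : W2 = - row_mx a b2 by [].
  rewrite mul_transv A1E.
  have -> : row_mx (1%:M + N *: a) (N *: b2) *m U2 = 1%:M.
    rewrite mul_row_col mulmx1 mulmxN -scalemxAl (mulmxA b2) b2Y mul1mx.
    by rewrite addrK.
  rewrite mul1mx scalerN scale_row_mx opp_row_mx add_row_mx.
  by rewrite addrK subrr.
(* The lower part of B stays divisible by N, with quotient d. *)
pose d := dsubmx (B1 - U1 *m (W1 *m B)
    - U2 *m (W2 *m (transv (- N) U1 W1 *m B))).
have B2E : transv (- N) U2 W2 *m (transv (- N) U1 W1 *m B)
    = col_mx 1%:M (N *: d).
  rewrite -[LHS]vsubmxK; congr col_mx.
    have : row_mx 1%:M 0
        *m (transv (- N) U2 W2 *m (transv (- N) U1 W1 *m B)) = 1%:M.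
      rewrite -A2E -!mulmxA (mulmxA (transv N U2 W2)) transvV // mul1mx.
      by rewrite (mulmxA (transv N U1 W1)) transvV // mul1mx.
    by rewrite -{1}[_ *m (_ *m B)]vsubmxK mul_row_col mul1mx mul0mx addr0.
  rewrite [_ *m (_ *m B)]transv_mul [X in X + _]transv_mul {1}BE.
  rewrite !scaleNr -!addrA -!scalerN -!scalerDr linearD /= col_mxKd add0r.
  by rewrite linearZ /= addrA.
exists U1, U2, (col_mx 0 d), W1, W2, (row_mx 1%:M 0); split=> //.
- by rewrite mul_row_col mulmx0 mul0mx addr0.
- rewrite A2E mul_transv mul_row_col mulmx0 mul0mx addr0 mul0mx scaler0.
  by rewrite addr0.
rewrite B2E transv_mul mul_row_col mul1mx mul0mx addr0 mulmx1.
by rewrite scale_col_mx add_col_mx scaler0 addr0 scaleNr subrr.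
Qed.

(** * Morphisms as split pairs *)

Lemma v2r_lfun (U V : vectType int) (f : 'Hom(U, V)) x :
  v2r (f x) = v2r x *m f2mx f.
Proof. by rewrite unlock /= r2vK. Qed.

Lemma f2mx_id (V : vectType int) : f2mx (\1 : 'End(V))%VF = 1%:M.
Proof.
apply/row_matrixP=> i; rewrite !rowE -[delta_mx 0 i]r2vK -v2r_lfun id_lfunE.
by rewrite mulmx1.
Qed.

Lemma f2mx_comp (U V W : vectType int) (f : 'Hom(V, W)) (g : 'Hom(U, V)) :
  f2mx (f \o g)%VF = f2mx g *m f2mx f.
Proof.
apply/row_matrixP=> i; rewrite !rowE -[delta_mx 0 i]r2vK -v2r_lfun comp_lfunE.
by rewrite !v2r_lfun mulmxA.
Qed.

Section Morphisms.
Implicit Types X Y Z : VICobj.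

Definition injmx X Y (f : VIChom X Y) := f2mx (vic_inj f).
Definition retmx X Y (f : VIChom X Y) := f2mx (vic_ret f).

Lemma injmx_retmx X Y (f : VIChom X Y) : injmx f *m retmx f = 1%:M.
Proof. by rewrite -f2mx_comp vic_retK f2mx_id. Qed.

Lemma vichom_eq X Y (f g : VIChom X Y) :
  injmx f = injmx g -> retmx f = retmx g -> f = g.
Proof.
rewrite /injmx /retmx; case: f g => [a b ab] [a' b' ab'] /=.
move=> /val_inj ea /val_inj eb.
by subst; congr MkVIChom; apply: eq_irrelevance.
Qed.

Fact mxhom_subproof X Y (A : 'M[int]_(dim X, dim Y)) (B : 'M_(dim Y, dim X)) :
  A *m B = 1%:M ->
  ((Hom B : 'Hom(vic_carrier Y, vic_carrier X)) \o Hom A = \1)%VF.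
Proof. by move=> AB; apply: val_inj; rewrite /= f2mx_comp f2mx_id. Qed.

Definition mxhom X Y (A : 'M[int]_(dim X, dim Y)) (B : 'M_(dim Y, dim X))
  (AB : A *m B = 1%:M) : VIChom X Y := MkVIChom (mxhom_subproof AB).

Lemma injmx_comp X Y Z (g : VIChom Y Z) (f : VIChom X Y) :
  injmx (vic_comp g f) = injmx f *m injmx g.
Proof. exact: f2mx_comp. Qed.

Lemma retmx_comp X Y Z (g : VIChom Y Z) (f : VIChom X Y) :
  retmx (vic_comp g f) = retmx g *m retmx f.
Proof. exact: f2mx_comp. Qed.

Lemma injmx_id X : injmx (vic_id X) = 1%:M. Proof. exact: f2mx_id. Qed.
Lemma retmx_id X : retmx (vic_id X) = 1%:M. Proof. exact: f2mx_id. Qed.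

(** Up to automorphisms of the target there is only one morphism, the standard
    inclusion, and it factors through every intermediate rank. *)
Lemma vic_factor X Y Z (f : VIChom X Z) : (dim X <= dim Y <= dim Z)%N ->
  exists (g : VIChom Y Z) (h : VIChom X Y), f = vic_comp g h.
Proof.
case/andP=> leXY leYZ.
have [g ug [AE BE]] :=
  split_pair_standard (leq_trans leXY leYZ) (injmx_retmx f).
have nYY : minn (dim Z) (minn (dim Y) (dim Y)) = dim Y.
  by rewrite minnn; apply/minn_idPr.
have nXX : minn (dim Y) (minn (dim X) (dim X)) = dim X.
  by rewrite minnn; apply/minn_idPr.
have XY : minn (dim Y) (minn (dim X) (dim Y)) = dim X.
  by rewrite (minn_idPl leXY) (minn_idPr leXY).
have YX : minn (dim Y) (minn (dim Y) (dim X)) = dim X.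
  by rewrite !(minn_idPr leXY).
have PQ : (pid_mx (dim Y) *m g : 'M_(dim Y, dim Z)) *m
          (invmx g *m pid_mx (dim Y)) = 1%:M.
  by rewrite mulmxA mulmxK // (mul_pid_mx_min _ _ nYY) pid_mx_1.
have AB : (pid_mx (dim X) : 'M[int]_(dim X, dim Y)) *m pid_mx (dim X) = 1%:M.
  by rewrite (mul_pid_mx_min _ _ nXX) pid_mx_1.
exists (mxhom PQ), (mxhom AB).
apply: vichom_eq; rewrite ?injmx_comp ?retmx_comp.
  by rewrite /injmx /= -/(injmx f) mulmxA (mul_pid_mx_min _ _ XY).
by rewrite /retmx /= -/(retmx f) -mulmxA (mul_pid_mx_min _ _ YX).
Qed.

Fact pid_iso_subproof X Y : dim X = dim Y ->
  (pid_mx (dim X) : 'M[int]_(dim X, dim Y)) *m pid_mx (dim X) = 1%:M.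
Proof.
by move=> eXY; rewrite (@mul_pid_mx_min _ _ _ (dim X)) ?pid_mx_1 // -eXY !minnn.
Qed.

Definition iso_hom X Y (eXY : dim X = dim Y) : VIChom X Y :=
  mxhom (pid_iso_subproof eXY).

Lemma iso_homK X Y (eXY : dim X = dim Y) (eYX : dim Y = dim X) :
  vic_comp (iso_hom eYX) (iso_hom eXY) = vic_id X.
Proof.
apply: vichom_eq; rewrite ?injmx_comp ?injmx_id ?retmx_comp ?retmx_id;
by rewrite (@mul_pid_mx_min _ _ _ (dim X)) ?pid_mx_1 // -eXY !minnn.
Qed.

Lemma iso_hom_comp X Y Z (eXY : dim X = dim Y) (eYZ : dim Y = dim Z)
  (eXZ : dim X = dim Z) : vic_comp (iso_hom eYZ) (iso_hom eXY) = iso_hom eXZ.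
Proof.
apply: vichom_eq; rewrite ?injmx_comp ?retmx_comp;
by rewrite (@mul_pid_mx_min _ _ _ (dim X)) ?pid_mx_1 // -?eYZ -?eXY !minnn.
Qed.

End Morphisms.

(** * The action of transvections *)

Section Representation.
Variables (R : comPzRingType) (V : VICmodule R).
Implicit Types X Y Z : VICobj.

Lemma slz_actP n (g : SLZ n) : (g^-1)%g *m (g : 'M_n) = 1%:M.
Proof. by have := congr1 val (mulVg g). Qed.

(** The inverse appears because rows are acted on from the right. *)
Definition slz_hom Y (g : SLZ (dim Y)) : VIChom Y Y := mxhom (slz_actP g).

Fact slz_hom1 Y x : vic_map V (slz_hom (1%g : SLZ (dim Y))) x = x.
Proof.
rewrite -[RHS]vic_map_id; congr (vic_map V _ _); apply: vichom_eq.
  by rewrite injmx_id /injmx /= invmx1.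
by rewrite retmx_id.
Qed.

Fact slz_homM Y (g h : SLZ (dim Y)) x : vic_map V (slz_hom (g * h)%g) x =
  vic_map V (slz_hom g) (vic_map V (slz_hom h) x).
Proof.
rewrite -vic_map_comp; congr (vic_map V _ _); apply: vichom_eq.
  rewrite injmx_comp /injmx /=.
  by have := congr1 val (invgM g h).
by rewrite retmx_comp.
Qed.

Definition slz_rep Y : representation (SLZ (dim Y)) (V Y) :=
  Representation (@slz_hom1 Y) (@slz_homM Y).

Lemma fg_module_surj (M M' : lmodType R) (f : {linear M -> M'}) :
  (forall y, exists x, f x = y) -> fg_module M -> fg_module M'.
Proof.
move=> sf [k [e [_ eP]]]; exists k, (f \o e); split=> // y _.
have [x <-] := sf y; have [c ->] := eP x I; exists c.
by rewrite linear_sum; apply: eq_bigr => i _; rewrite linearZ.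
Qed.

Hypothesis hpfg : vic_pointwise_fg V.

Lemma dim_std n (hn : (2 < n)%N) : dim (vic_std hn) = n.
Proof. exact: mul1n. Qed.

Lemma pointwise_fg Y : fg_module (V Y).
Proof.
have eY := dim_std (vic_rank Y).
apply: (@fg_module_surj _ _ (vic_map V (iso_hom eY))) (hpfg _) => y.
exists (vic_map V (iso_hom (esym eY)) y).
by rewrite -vic_map_comp iso_homK vic_map_id.
Qed.

Hypothesis hSL : SL_finite R.

(** Starting from 1 - U W makes the matrix of [slz_hom] of the power equal to
    1 + N U W. *)
Lemma slmx_transvX m n (U : 'M[int]_(n, m)) (W : 'M_(m, n)) (g : SLZ n) N :
  W *m U = 0 -> (g : 'M_n) = transv (-1) U W ->
  ((g ^+ N)%g : 'M_n) = transv (- N%:Z) U W.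
Proof.
move=> WU gE; elim: N => [|N IHN]; first by rewrite oppr0 transv0.
rewrite expgS -[LHS]/((g : 'M_n) *m ((g ^+ N)%g : 'M_n)) IHN gE transvD //.
by rewrite intS opprD.
Qed.

(** N is the order of a finite group through which the action factors, so it
    kills every element of that group, in particular the image of each
    1 + U W. *)
Lemma transv_act_trivially Y : exists N : nat, (0 < N)%N /\
  forall m (U : 'M[int]_(dim Y, m)) W (WU : W *m U = 0) (f : VIChom Y Y) x,
  injmx f = transv N U W -> vic_map V f x = x.
Proof.
have [Q [p [rhoQ [_ rhoE]]]] := hSL (vic_rank Y) (slz_rep Y) (pointwise_fg Y).
exists #|Q|; split=> [|m U W WU f x fE].
  by apply/card_gt0P; exists 1%g.
have dg : \det (transv (-1) U W) == 1 by rewrite det_transv.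
pose g : SLZ (dim Y) := MkSLZ dg.
have gN := slmx_transvX #|Q| WU (erefl : (g : 'M_(dim Y)) = _).
have -> : f = slz_hom (g ^+ #|Q|)%g.
  have fT : injmx f = transv #|Q| U W := fE.
  have fR : retmx f = ((g ^+ #|Q|)%g : 'M_(dim Y)).
    have uT : transv #|Q| U W \in unitmx by rewrite unitmxE det_transv ?unitr1.
    have := injmx_retmx f; rewrite fT gN => /(canRL (mulKmx uT)) ->.
    by apply: (canLR (mulKmx uT)); rewrite transvV.
  apply: vichom_eq; last exact: fR.
  have uT : retmx f \in unitmx by case: (mulmx1_unit (injmx_retmx f)).
  rewrite -[LHS](mulmxK uT) injmx_retmx mul1mx fR.
  by rewrite /injmx /=.
have -> : vic_map V (slz_hom (g ^+ #|Q|)%g) x = rhoQ (p (g ^+ #|Q|)%g) x.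
  exact: rhoE.
have pX k : p (g ^+ k.+1)%g = (p g ^+ k.+1)%g.
  by elim: k => [|k IHk]; rewrite ?expg1 // expgS gmulfM IHk -expgS.
have Q0 : (0 < #|Q|)%N by apply/card_gt0P; exists 1%g.
rewrite -(prednK Q0) pX prednK //.
have /dvdnP[k kE] : (#[p g]%g %| #|[set: Q]|)%N by apply: cardSg (subsetT _).
by rewrite -cardsT kE mulnC expgM expg_order expg1n rep_act1.
Qed.

(** The bound N is found in rank 3 dim X and serves all larger ranks:
    a transvection there and a morphism from X both restrict to one summand of
    rank 3 dim X, where the transvection acts trivially. *)
Lemma act_through_congruence_class X (v : V X) : exists N : nat, (0 < N)%N /\
  forall Z (f f' : VIChom X Z), (dim X + (dim X + dim X) <= dim Z)%N ->
  (exists C, injmx f = injmx f' + N%:Z *: C) ->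
  (exists D, retmx f = retmx f' + N%:Z *: D) ->
  vic_map V f v = vic_map V f' v.
Proof.
set m := dim X; have l_gt2 : (2 < m + (m + m))%N.
  by rewrite (leq_trans (vic_rank X)) ?leq_addr.
have [N [N0 NP]] := transv_act_trivially (vic_std l_gt2).
exists N; split=> // Z f f' len.
have eY : dim (vic_std l_gt2) = (m + (m + m))%N := dim_std l_gt2.
have transv_fix (U : 'M[int]_(dim Z, m)) W (WU : W *m U = 0) (h : VIChom X Z) :
    vic_map V (vic_comp (mxhom (transvV N WU)) h) v = vic_map V h v.
  have [|P [Q [A0 [W0 [B0 [U0 [PQ AB0 WU0 [AE BE UE WE]]]]]]]] :=
    split_pair_transvection_factor eY _ (injmx_retmx h) WU; first by rewrite eY.
  have -> : h = vic_comp (mxhom PQ) (mxhom AB0).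
    by apply: vichom_eq; rewrite ?injmx_comp ?retmx_comp ?AE ?BE.
  have -> : vic_comp (mxhom (transvV N WU)) (vic_comp (mxhom PQ) (mxhom AB0)) =
      vic_comp (mxhom PQ) (vic_comp (mxhom (transvV N WU0)) (mxhom AB0)).
    apply: vichom_eq; rewrite !(injmx_comp, retmx_comp) /injmx /retmx /=.
      rewrite -!mulmxA; congr (_ *m _); rewrite mul_transv transv_mul UE WE.
      by rewrite (mulmxA P) PQ mul1mx.
    rewrite !mulmxA; congr (_ *m _); rewrite mul_transv transv_mul UE WE.
    by rewrite -!mulmxA PQ mulmx1.
  rewrite !vic_map_comp; congr (vic_map V _ _).
  by apply: (NP _ _ _ WU0).
have lmZ : (m <= dim Z)%N by apply: leq_trans len; rewrite leq_addr.
have [g ug [AE BE]] := split_pair_standard lmZ (injmx_retmx f').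
case=> C CE [D DE].
have AB : (injmx f *m invmx g) *m (g *m retmx f) = 1%:M.
  by rewrite mulmxA mulmxKV // injmx_retmx.
have A1 : injmx f *m invmx g = pid_mx m + N%:Z *: (C *m invmx g).
  by rewrite CE mulmxDl AE mulmxK // scalemxAl.
have B1 : g *m retmx f = pid_mx m + N%:Z *: (g *m D).
  by rewrite DE mulmxDr BE mulKVmx // scalemxAr.
have [U1 [U2 [U3 [W1 [W2 [W3 [WU1 WU2 WU3 PA PB]]]]]]] :=
  congruent_split_pair_transvections len AB A1 B1.
have conjWU (U : 'M[int]_(dim Z, m)) W :
    W *m U = 0 -> (W *m g) *m (invmx g *m U) = 0.
  by move=> WU; rewrite mulmxA mulmxK.
have conjT N' (U : 'M[int]_(dim Z, m)) W :
    transv N' (invmx g *m U) (W *m g) = invmx g *m transv N' U W *m g.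
  rewrite mul_transv mulmxDl mulVmx // /transv -scalemxAl; congr (_ + _ *: _).
  by rewrite !mulmxA.
rewrite -(transv_fix _ _ (conjWU _ _ _ WU1)).
rewrite -(transv_fix _ _ (conjWU _ _ _ WU2)).
rewrite -(transv_fix _ _ (conjWU _ _ _ WU3)); congr (vic_map V _ _).
apply: vichom_eq; rewrite !(injmx_comp, retmx_comp) /injmx /retmx /=.
  rewrite -/(injmx f) -/(injmx f') !conjT [RHS]AE -PA !mulmxA.
  by rewrite !(mulmxK ug).
rewrite -/(retmx f) -/(retmx f') !conjT [RHS]BE -PB -!mulmxA.
by rewrite !(mulKVmx ug).
Qed.
End Representation.

(** * Spans and sequences in Noetherian rings *)

Lemma ex_min (P : nat -> Prop) : (exists n, P n) ->
  exists2 n, P n & forall k, P k -> (n <= k)%N.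
Proof.
case=> n; elim/ltn_ind: n => n IHn Pn.
have [[k [lt_kn Pk]]|no] := classic (exists k, (k < n)%N /\ P k).
  exact: IHn Pk.
by exists n => // k Pk; rewrite leqNgt; apply/negP=> lt_kn; apply: no; exists k.
Qed.

Section Submodules.
Variables (R : comPzRingType) (M : lmodType R).

Lemma submoduleZ (P : M -> Prop) : is_submodule P ->
  forall a x, P x -> P (a *: x).
Proof. by case=> P0 PD a x Px; rewrite -[_ *: _]addr0; apply: PD. Qed.

Lemma submoduleD (P : M -> Prop) : is_submodule P ->
  forall x y, P x -> P y -> P (x + y).
Proof. by case=> P0 PD x y Px Py; rewrite -[x]scale1r; apply: PD. Qed.

Lemma submoduleB (P : M -> Prop) : is_submodule P ->
  forall x y, P x -> P y -> P (x - y).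
Proof.
by case=> P0 PD x y Px Py; rewrite -scaleN1r addrC; apply: PD.
Qed.

Lemma submodule_sum (P : M -> Prop) : is_submodule P ->
  forall (I : Type) (r : seq I) (F : I -> M), (forall i, P (F i)) ->
  P (\sum_(i <- r) F i).
Proof.
move=> sP I r F PF; elim/big_rec: _ => [|i x _]; first by case: sP.
exact: submoduleD.
Qed.

(** The span is taken impredicatively, as the intersection of all submodules
    containing S: membership is then used by choosing a submodule, without
    handling linear combinations. *)
Definition lspan (S : M -> Prop) : M -> Prop :=
  fun y => forall P, is_submodule P -> (forall x, S x -> P x) -> P y.

Lemma lspan_submodule S : is_submodule (lspan S).
Proof.
split=> [P [P0 _] //|a x y Sx Sy P sP SP].
by case: (sP) => _; apply; [apply: Sx|apply: Sy].
Qed.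

Lemma lspan_sub (S : M -> Prop) x : S x -> lspan S x.
Proof. by move=> Sx P _; apply. Qed.

Lemma lspan_mono (S T : M -> Prop) :
  (forall x, S x -> lspan T x) -> forall x, lspan S x -> lspan T x.
Proof. by move=> ST x; apply=> //; apply: lspan_submodule. Qed.

End Submodules.

(** The ideals spanned by initial segments of the sequence increase; a finite
    set of generators of their union already lies in one of them. *)
Lemma noetherian_sequence (R : comPzRingType) : noetherian R ->
  forall a : nat -> R,
  exists t, forall P : R^o -> Prop, is_submodule P ->
    (forall s, (s < t)%N -> P (a s)) -> P (a t).
Proof.
move=> hN a; pose J t := lspan (fun r : R^o => exists2 s, (s < t)%N & r = a s).
have J_mono t u r : (t <= u)%N -> J t r -> J u r.
  move=> le_tu; apply: lspan_mono => _ [s lt_st ->]; apply: lspan_sub.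
  by exists s => //; apply: leq_trans le_tu.
have J_sub t : is_submodule (J t) by apply: lspan_submodule.
have [|k [e [eJ eP]]] := hN (fun r => exists t, J t r).
  split=> [|b x y [t Jx] [u Jy]]; first by exists 0%N; case: (J_sub 0%N).
  exists (maxn t u); case: (J_sub (maxn t u)) => _; apply.
    by apply: J_mono Jx; rewrite leq_maxl.
  by apply: J_mono Jy; rewrite leq_maxr.
pose T i := proj1_sig (constructive_indefinite_description _ (eJ i)).
have TP i : J (T i) (e i).
  exact: proj2_sig (constructive_indefinite_description _ (eJ i)).
pose t := (\max_i T i)%N; exists t => P sP Pa.
have [|c ->] := eP (a t).
  by exists t.+1; apply: lspan_sub; exists t.
apply: submodule_sum => // i; apply: submoduleZ => //.
apply: (TP i) => // _ [s lt_s ->]; apply: Pa; apply: leq_trans lt_s _.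
exact: leq_bigmax.
Qed.

(** * A Hilbert basis theorem for VIC-modules *)

Section Generation.
Variables (R : comPzRingType) (V : VICmodule R).

Definition vspan (s : seq {X : VICobj & V X}) (Y : VICobj) : V Y -> Prop :=
  lspan (fun y => exists (t : {X : VICobj & V X}) (f : VIChom (tag t) Y),
    List.In t s /\ y = vic_map V f (tagged t)).

Lemma vspan_submodule s Y : is_submodule (@vspan s Y).
Proof. exact: lspan_submodule. Qed.

Lemma vspan_mono s s' Y (y : V Y) :
  (forall t, List.In t s -> List.In t s') -> vspan s y -> vspan s' y.
Proof.
move=> ss'; apply: lspan_mono => _ [t [f [st ->]]]; apply: lspan_sub.
by exists t, f; split=> //; apply: ss'.
Qed.

End Generation.

(** The abstract form of the argument.  In each object Z satisfying [big] the
    module is spanned by vectors [ev w] indexed by words and totally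
    preordered by [rank]; [le w w'] provides a morphism that takes the term w
    to the term w' and keeps smaller terms smaller, which is what makes leading
    coefficients comparable between different objects. *)
Section Groebner.
Variables (R : comPzRingType) (V : VICmodule R) (U : VICsubmodule V).
Hypothesis hN : noetherian R.
Variables (big : VICobj -> Prop) (W : VICobj -> Type).
Variables (rank : forall Z, W Z -> nat) (ev : forall Z, W Z -> V Z).
Variable le : forall Y Z, W Y -> W Z -> Prop.

Hypothesis ev_span : forall Z (y : V Z), big Z ->
  lspan (fun x => exists w : W Z, x = ev w) y.
Hypothesis ev_rank : forall Z (w w' : W Z), big Z ->
  rank w = rank w' -> ev w = ev w'.
Hypothesis le_transport : forall Y Z (w : W Y) (w' : W Z), big Y -> big Z ->
  le w w' -> exists f : VIChom Y Z, ev w' = vic_map V f (ev w) /\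
  forall u, (rank u < rank w)%N -> exists2 u', (rank u' < rank w')%N &
    vic_map V f (ev u) = ev u'.
Hypothesis le_wqo : forall x : nat -> {Z : VICobj & W Z},
  (forall i, big (tag (x i))) -> exists2 e : nat -> nat,
    (forall i j, (i < j)%N -> (e i < e j)%N) &
    forall i j, (i < j)%N -> le (tagged (x (e i))) (tagged (x (e j))).

Let below Z (r : nat) : V Z -> Prop :=
  lspan (fun x => exists2 w : W Z, (rank w < r)%N & x = ev w).

Let belowP Z r : is_submodule (@below Z r).
Proof. exact: lspan_submodule. Qed.

Let below_mono Z r s (y : V Z) : (r <= s)%N -> below r y -> below s y.
Proof.
move=> le_rs; apply: lspan_mono => _ [w lt_w ->]; apply: lspan_sub.
by exists w => //; apply: leq_trans le_rs.
Qed.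

Let below_ex Z (y : V Z) : big Z -> exists r, below r y.
Proof.
move=> bZ.
apply: (ev_span y bZ (P := fun y => exists r, below r y)) => [|_ [w ->]].
  split=> [|a x z [r Bx] [s Bz]]; first by exists 0%N; case: (belowP Z 0).
  exists (maxn r s); case: (belowP Z (maxn r s)) => _; apply.
    by apply: below_mono Bx; rewrite leq_maxl.
  by apply: below_mono Bz; rewrite leq_maxr.
by exists (rank w).+1; apply: lspan_sub; exists w.
Qed.

(** Splits off a leading term: by [ev_rank] all words of the top rank give the
    same vector, so their coefficients add up. *)
Let below_lead Z r (y : V Z) : big Z -> below r.+1 y ->
  below r y \/ exists (w : W Z) a, rank w = r /\ below r (y - a *: ev w).
Proof.
move=> bZ By.
apply: (By (fun y => below r y \/ exists (w : W Z) a,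
  rank w = r /\ below r (y - a *: ev w))) => [|_ [w lt_w ->]].
  have [B0 _] := belowP Z r.
  split=> [|a x z]; first by left.
  case=> [Bx|[w [b [wr Bx]]]] [Bz|[w' [b' [wr' Bz]]]].
  - by left; case: (belowP Z r) => _; apply.
  - right; exists w', b'; split=> //; rewrite -addrA.
    by case: (belowP Z r) => _; apply.
  - right; exists w, (a * b); split=> //; rewrite addrAC -scalerA -scalerBr.
    by case: (belowP Z r) => _; apply.
  right; exists w, (a * b + b'); split=> //.
  rewrite scalerDl -scalerA opprD addrACA -scalerBr.
  rewrite [in b' *: _](ev_rank bZ (etrans wr (esym wr'))).
  by case: (belowP Z r) => _; apply.
move: lt_w; rewrite ltnS leq_eqVlt => /orP[/eqP rw|lt_w].
  right; exists w, 1; split=> //; rewrite scale1r subrr.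
  by case: (belowP Z r).
by left; apply: lspan_sub; exists w.
Qed.

(** Bundled, since the argument chooses sequences of all four data at once. *)
Record lead_term := LeadTerm {
  lead_obj : VICobj;
  lead_vec : V lead_obj;
  lead_word : W lead_obj;
  lead_coef : R
}.

Let elt (d : lead_term) : {X : VICobj & V X} :=
  Tagged (fun X => V X) (lead_vec d).

(** The last clause is the form in which minimality of the leading rank is
    used: a vector of U at the same object with smaller terms is generated
    by s. *)
Let minimal_outside (s : seq {X : VICobj & V X}) (d : lead_term) :=
  let: LeadTerm Z y w a := d in
  [/\ big Z, U Z y, ~ vspan s y, below (rank w) (y - a *: ev w) &
   forall x : V Z, U Z x -> below (rank w) x -> vspan s x].

Let ex_minimal_outside s :
  ~ (forall Z (y : V Z), big Z -> U Z y -> vspan s y) ->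
  exists d, minimal_outside s d.
Proof.
move=> nG; pose P r := exists Z (y : V Z),
  [/\ big Z, U Z y, ~ vspan s y & below r y].
have [|[|r] [Z [y [bZ Uy ny By]]] rmin] := @ex_min P.
- apply: NNPP => no; apply: nG => Z y bZ Uy; apply: NNPP => ny.
  by have [r By] := below_ex y bZ; apply: no; exists r, Z, y.
- case: ny; suff -> : y = 0 by case: (vspan_submodule s Z).
  apply: (By (fun y => y = 0)) => [|_ [w]] //.
  by split=> // a x z -> ->; rewrite scaler0 addr0.
have min x : U Z x -> below r x -> vspan s x.
  move=> Ux Bx; apply: NNPP => nx.
  by have /rmin: P r; [exists Z, x | rewrite ltnn].
have [|[w [a [wr Ba]]]] := below_lead bZ By; first by move/(min _ Uy).
by exists (LeadTerm y w a); split; rewrite ?wr.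
Qed.

(** If no finite list generates, pick vectors of U one after another, each of
    minimal leading rank outside what its predecessors generate.  Along a
    chain of comparable leading words some leading coefficient is a combination
    of earlier ones, so transporting the earlier vectors cancels the leading
    term of the later one without changing the submodule it lies outside of:
    this contradicts minimality. *)
Theorem groebner_generation : exists s : seq {X : VICobj & V X},
  (forall t, List.In t s -> U (tag t) (tagged t)) /\
  forall Z (y : V Z), big Z -> U Z y -> vspan s y.
Proof.
apply: NNPP => no.
pose inU s := forall t : {X : VICobj & V X},
  List.In t s -> U (tag t) (tagged t).
have next s : exists d, inU s -> minimal_outside s d.
  have [sU|nsU] := classic (inU s).
    have [|d dP] := @ex_minimal_outside s; last by exists d.
    by move=> sG; apply: no; exists s.
  (* This case only makes the choice function total: the lists to which it is
     applied stay inside U. *)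
  suff [d] : exists d, minimal_outside [::] d by exists d.
  by apply: ex_minimal_outside => nil_gen; apply: no; exists [::].
pose pick s := proj1_sig (constructive_indefinite_description _ (next s)).
have pickP s : inU s -> minimal_outside s (pick s).
  exact: proj2_sig (constructive_indefinite_description _ (next s)).
pose hist := fix hist n :=
  if n is n'.+1 then elt (pick (hist n')) :: hist n' else [::].
have histU n t : List.In t (hist n) -> U (tag t) (tagged t).
  elim: n t => //= n IHn t [<-|]; last exact: IHn.
  by have := pickP _ IHn; case: (pick _) => Z y w a [].
pose d n := pick (hist n).
have dP n : minimal_outside (hist n) (d n) by apply: pickP (@histU n).
have d_hist i j : (i < j)%N -> List.In (elt (d i)) (hist j).
  elim: j => // j IHj; rewrite ltnS leq_eqVlt.
  by case/orP=> [/eqP->|/IHj]; [left | right].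
have [|e e_mono e_le] := @le_wqo (fun n => Tagged W (lead_word (d n))).
  by move=> n; have := dP n; case: (d n) => Z y w a [].
have [t tP] := noetherian_sequence hN (fun n => lead_coef (d (e n))).
set Z := lead_obj (d (e t)).
pose y : V Z := lead_vec (d (e t)); pose w : W Z := lead_word (d (e t)).
have [bZ Uy ny By ymin] : [/\ big Z, U Z y, ~ vspan (hist (e t)) y,
   below (rank w) (y - lead_coef (d (e t)) *: ev w) &
   forall x : V Z, U Z x -> below (rank w) x -> vspan (hist (e t)) x].
  by have := dP (e t); rewrite /y /w /Z; case: (d (e t)).
(* The coefficients of ev w that can be cancelled using earlier vectors. *)
pose P (r : R^o) := exists z : V Z,
  [/\ U Z z, vspan (hist (e t)) z & below (rank w) (z - r *: ev w)].
have [U0 UD] := vsub_submodule U Z.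
have [] : P (lead_coef (d (e t))).
  apply: tP => [|s lt_st].
    have [S0 SD] := vspan_submodule (hist (e t)) Z.
    have [B0 BD] := belowP Z (rank w).
    split=> [|a r r' [z [Uz Sz Bz]] [z' [Uz' Sz' Bz']]].
      by exists 0; split=> //; rewrite scale0r subr0.
    exists (a *: z + z'); split; [exact: UD|exact: SD|].
    rewrite scalerDl opprD addrACA -scalerA -scalerBr; exact: BD.
  have := dP (e s); have := e_le _ _ lt_st.
  have := d_hist _ _ (e_mono _ _ lt_st); rewrite -/w /elt /=.
  case: (d (e s)) => Z' y' w' a' /= y'_hist le_w [bZ' Uy' _ By' _].
  have [f [evf f_below]] := le_transport bZ' bZ le_w.
  exists (vic_map V f y'); split; first exact: vsub_map.
    by apply: lspan_sub; exists (existT _ Z' y'), f.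
  rewrite evf -linearZ -linearB.
  apply: (By' (fun x => below (rank w) (vic_map V f x))) => [|_ [u lt_u ->]].
    have [B0 BD] := belowP Z (rank w).
    by split=> [|a x z Bx Bz]; rewrite ?linear0 ?linearP //; apply: BD.
  by have [u' lt_u' ->] := f_below _ lt_u; apply: lspan_sub; exists u'.
move=> z [Uz Sz Bz]; apply: ny; rewrite -[y](subrK z).
apply: (submoduleD (vspan_submodule _ _)) => //.
apply: ymin; first by apply: (submoduleB (vsub_submodule U Z)).
have -> : y - z = (y - lead_coef (d (e t)) *: ev w)
    - (z - lead_coef (d (e t)) *: ev w) by rewrite opprB addrA subrK.
by apply: (submoduleB (belowP Z _)).
Qed.

End Groebner.

Local Close Scope ring_scope.

(** * Well-quasi-orders and Higman's lemma *)

Section WellQuasiOrders.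
Variable T : Type.
Implicit Types (P Q : T -> Prop) (R S : T -> T -> Prop) (x : nat -> T).

(** The chain form of the definition is used since it passes to conjunctions of
    relations; P restricts the sequences considered. *)
Definition wqo P R := forall x, (forall i, P (x i)) ->
  exists2 e : nat -> nat, (forall i j, i < j -> e i < e j) &
    forall i j, i < j -> R (x (e i)) (x (e j)).

Lemma homo_lt_step R x : (forall a b c, R a b -> R b c -> R a c) ->
  (forall n, R (x n) (x n.+1)) -> forall i j, i < j -> R (x i) (x j).
Proof.
move=> Rtr Rx i; elim=> // j IHj; rewrite ltnS leq_eqVlt => /orP[/eqP->|lt_ij].
  exact: Rx.
exact: Rtr (IHj lt_ij) (Rx j).
Qed.

Lemma ex_iter_above (C : nat -> nat -> Prop) n0 :
  (forall n, n0 <= n -> exists2 m, n < m & C n m) ->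
  exists e : nat -> nat, [/\ n0 <= e 0, forall i, e i < e i.+1 &
    forall i, C (e i) (e i.+1)].
Proof.
move=> stepC; have next n : exists m, n0 <= n -> n < m /\ C n m.
  have [le_n|_] := boolP (n0 <= n); last by exists 0.
  by have [m lt_nm Cnm] := stepC n le_n; exists m.
pose f n := proj1_sig (constructive_indefinite_description _ (next n)).
have fP n : n0 <= n -> n < f n /\ C n (f n).
  exact: proj2_sig (constructive_indefinite_description _ (next n)).
have e_ge i : n0 <= iter i f n0.
  by elim: i => //= i IHi; have [/ltnW/(leq_trans IHi)] := fP _ IHi.
exists (fun i => iter i f n0); split=> // i; by have [] := fP _ (e_ge i).
Qed.

(** For a transitive relation one comparable pair in each sequence is enough:
    the indices below no later one are finitely many, as they would otherwise
    form a sequence without such a pair; beyond them the chain can always be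
    continued. *)
Lemma wqo_good P R : (forall a b c, R a b -> R b c -> R a c) ->
  (forall x, (forall i, P (x i)) -> exists i j, i < j /\ R (x i) (x j)) ->
  wqo P R.
Proof.
move=> Rtr good x Px.
pose terminal i := forall j, i < j -> ~ R (x i) (x j).
have [n0 n0P] : exists n0, forall i, n0 <= i -> ~ terminal i.
  apply: NNPP => no.
  have [|e [_ e_step e_term]] := @ex_iter_above (fun _ m => terminal m) 0.
    move=> n _; apply: NNPP => no'; apply: no; exists n.+1 => i lt_ni it.
    by apply: no'; exists i.
  have [i|i [j [lt_ij Rij]]] := good (fun i => x (e i.+1)); first exact: Px.
  apply: (e_term i) Rij.
  by apply: (homo_ltn ltn_trans e_step).
have [|e [_ e_step Re]] := @ex_iter_above (fun n m => R (x n) (x m)) n0.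
  move=> n le_n; apply: NNPP => no; apply: (n0P n le_n) => j lt_nj Rnj.
  by apply: no; exists j.
exists e; first exact: (homo_ltn ltn_trans e_step).
exact: (@homo_lt_step R (fun i => x (e i))).
Qed.

Lemma wqo_sub P Q R S : (forall a, Q a -> P a) ->
  (forall a b, Q a -> Q b -> R a b -> S a b) -> wqo P R -> wqo Q S.
Proof.
move=> QP RS wR x Qx; have [i|e e_mono Re] := wR x; first exact: QP.
by exists e => // i j lt_ij; apply: RS => //; apply: Re.
Qed.

Lemma wqo_and P R S : wqo P R -> wqo P S -> wqo P (fun a b => R a b /\ S a b).
Proof.
move=> wR wS x Px; have [e e_mono Re] := wR x Px.
have [i|e' e'_mono Se'] := wS (x \o e); first exact: Px.
exists (e \o e') => [i j lt_ij|i j lt_ij]; first by apply/e_mono/e'_mono.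
by split; [apply/Re/e'_mono | apply: Se'].
Qed.

End WellQuasiOrders.

Lemma wqo_preim T T' (f : T' -> T) P R : wqo P R ->
  wqo (fun a => P (f a)) (fun a b => R (f a) (f b)).
Proof. by move=> wR x Px; apply: (wR (f \o x)). Qed.

Lemma wqo_fin (T : finType) : wqo (fun _ : T => True) eq.
Proof.
apply: wqo_good => [a b c -> //|x _].
pose f (i : 'I_#|T|.+1) := x i.
have /injectivePn[i [j ij fij]] : ~~ injectiveb f.
  apply/negP=> /injectiveP/leq_card; by rewrite card_ord ltnn.
rewrite /f in fij; move: ij; rewrite neq_ltn => /orP[lt|lt].
  by exists i, j.
by exists j, i.
Qed.

Lemma wqo_or T (P Q : T -> Prop) R : wqo P R -> wqo Q R ->
  wqo (fun a => P a \/ Q a) R.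
Proof.
move=> wP wQ x PQx.
have dec i : exists b : bool, if b then P (x i) else Q (x i).
  by case: (PQx i); [exists true | exists false].
pose c i := proj1_sig (constructive_indefinite_description _ (dec i)).
have cP i : if c i then P (x i) else Q (x i).
  exact: proj2_sig (constructive_indefinite_description _ (dec i)).
have [i|e e_mono ce] := @wqo_fin bool c; first by [].
have {}ce i : c (e i) = c (e 0) by case: i => // i; rewrite (ce 0 i.+1).
have [e' e'_mono Re'] : exists2 e', (forall i j, i < j -> e' i < e' j) &
    forall i j, i < j -> R (x (e (e' i))) (x (e (e' j))).
  have cPe i := cP (e i); case c0: (c (e 0)) in ce.
    by apply: (wP (x \o e)) => i; have := cPe i; rewrite ce.
  by apply: (wQ (x \o e)) => i; have := cPe i; rewrite ce.
by exists (e \o e') => // i j lt_ij; apply/e_mono/e'_mono.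
Qed.

Section Higman.
Variable A : finType.
Implicit Types (D : {set A}) (s t p : seq A).

(** A word avoiding a :: p either does not contain a, or splits at its first a
    into a word without a and a word avoiding p.  So the claim reduces to
    smaller alphabets and shorter patterns. *)
Lemma wqo_avoid D p : (forall a, a \in D ->
    wqo (fun s => {subset s <= D :\ a}) (fun s t => subseq s t)) ->
  {subset p <= D} ->
  wqo (fun s => {subset s <= D} /\ ~~ subseq p s) (fun s t => subseq s t).
Proof.
move=> wD; elim: p => [_ x /(_ 0)[_]|a p IHp apD]; first by rewrite sub0seq.
have aD : a \in D by apply: apD; rewrite mem_head.
have {IHp} wp : wqo (fun s => {subset s <= D} /\ ~~ subseq p s)
    (fun s t => subseq s t).
  by apply: IHp => b pb; apply: apD; rewrite inE pb orbT.
pose u s := take (index a s) s; pose v s := drop (index a s).+1 s.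
have uv s : a \in s -> s = u s ++ a :: v s.
  move=> sa; rewrite -{1}[s](cat_take_drop (index a s)); congr cat.
  by rewrite (drop_nth a) ?index_mem // nth_index.
pose P1 s := {subset s <= D :\ a}.
pose P2 s := a \in s /\ ({subset u s <= D :\ a} /\
   ({subset v s <= D} /\ ~~ subseq p (v s))).
apply: (@wqo_sub _ (fun s => P1 s \/ P2 s) _ (fun s t => subseq s t)) => //.
  move=> s [sD Nps]; have [sa|nsa] := boolP (a \in s); [right|left].
    split=> //; split=> [b ub|].
      rewrite !inE sD ?andbT; last by rewrite (mem_take ub).
      apply: contraTneq ub => ->; rewrite in_take ?ltnn //.
    split=> [b vb|]; first by rewrite sD ?(mem_drop vb).
    apply: contra Nps => pv; rewrite (uv s sa).
    by apply: (@subseq_trans _ (a :: v s)); rewrite ?suffix_subseq //= eqxx.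
  by move=> b sb; rewrite !inE sD // andbT; apply: contraNneq nsa => <-.
apply: wqo_or; first exact: wD.
have wu : wqo P2 (fun s t => subseq (u s) (u t)).
  by apply: (wqo_sub _ _ (wqo_preim (f := u) (wD a aD))) => // s [_ []].
have wv : wqo P2 (fun s t => subseq (v s) (v t)).
  by apply: (wqo_sub _ _ (wqo_preim (f := v) wp)) => // s [_ []].
apply: (wqo_sub _ _ (wqo_and wu wv)) => //.
move=> s t [sa _] [ta _] [us vs]; rewrite (uv s sa) (uv t ta).
by rewrite cat_subseq //= eqxx.
Qed.

(** By induction on the alphabet: in a sequence without comparable pair, all
    words but the first one avoid the first one. *)
Theorem higman : wqo (fun _ : seq A => True) (fun s t => subseq s t).
Proof.
suff wD D : wqo (fun s => {subset s <= D}) (fun s t => subseq s t).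
  by apply: wqo_sub (wD setT) => // s _ a _; rewrite inE.
have [n] := ubnP #|D|; elim: n => // n IHn in D *; rewrite ltnS => le_D.
apply: wqo_good => [a b c|x xD]; first exact: subseq_trans.
have [[j sub_x0]|no] := classic (exists j, subseq (x 0) (x j.+1)).
  by exists 0, j.+1.
have [||i|e e_mono Re] := @wqo_avoid D (x 0) _ _ (fun i => x i.+1) _.
- move=> a aD; apply: IHn; apply: leq_trans le_D.
  by rewrite [leqRHS](cardsD1 a) aD.
- exact: xD.
- by split; [apply: xD | apply/negP=> sub_x0; apply: no; exists i].
by exists (e 0).+1, (e 1).+1; rewrite ltnS e_mono // Re.
Qed.

End Higman.

Lemma subseq_embedding (A : eqType) (s t : seq A) : subseq s t ->
  exists f : nat -> nat,
   [/\ forall i, i < size s -> f i < size t,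
       forall i x0, i < size s -> nth x0 t (f i) = nth x0 s i &
       forall i j, i < j < size s -> f i < f j].
Proof.
elim: t s => [|y t IHt] [|x s] //=.
- by exists id; split=> // i j; rewrite ltn0 andbF.
- by exists id; split=> // i j; rewrite ltn0 andbF.
case: eqP => [<-|_] /IHt[f [fs fn fm]].
  exists (fun i => if i is i'.+1 then (f i').+1 else 0).
  split=> [[|i]|[|i]|[|i] [|j]] //=.
  - exact: fs.
  - by move=> x0 /fn->.
  exact: (fm i j).
by exists (fun i => (f i).+1); split.
Qed.

Lemma codom_embedding (A : eqType) n p (d : 'I_n -> A) (d' : 'I_p -> A) :
  subseq (codom d) (codom d') ->
  exists f : 'I_n -> 'I_p, (forall i, d' (f i) = d i) /\
    (forall i j : 'I_n, i < j -> f i < f j).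
Proof.
move=> /subseq_embedding[f []]; rewrite !size_codom !card_ord => fs fn fm.
exists (fun i : 'I_n => Ordinal (fs i (ltn_ord i))).
split=> [i|i j lt_ij] /=; last by apply: fm; rewrite lt_ij ltn_ord.
have := fn i (d i) (ltn_ord i); rewrite /codom /image_mem.
rewrite (nth_map i) ?size_enum_ord // nth_ord_enum => <-.
set k := Ordinal _; rewrite (nth_map k) ?size_enum_ord ?fs //.
by congr d'; apply: val_inj; rewrite /= nth_enum_ord ?fs.
Qed.

(** * The order on words *)

(** Lexicographic comparison of bounded sequences is encoded by numbers in
    base b, so that ranks are natural numbers. *)
Section LexNumbers.
Variable b : nat.

Fixpoint lexnum n : ('I_n -> nat) -> nat :=
  if n is n'.+1
  then fun f => f ord0 * b ^ n' + lexnum (fun i => f (lift ord0 i))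
  else fun _ => 0.

Definition lexlt n (f g : 'I_n -> nat) :=
  exists j : 'I_n, (forall i : 'I_n, i < j -> f i = g i) /\ f j < g j.

Lemma eq_lexlt n (f f' g g' : 'I_n -> nat) : f =1 f' -> g =1 g' ->
  lexlt f g -> lexlt f' g'.
Proof.
move=> ff gg [j [jeq jlt]]; exists j; rewrite -ff -gg; split=> // i /jeq.
by rewrite ff gg.
Qed.

Lemma lexnum_bound n (f : 'I_n -> nat) :
  (forall i, f i < b) -> lexnum f < b ^ n.
Proof.
elim: n f => [|n IHn] f fb; first by [].
rewrite /= expnS; apply: (@leq_trans ((f ord0).+1 * b ^ n)).
  by rewrite mulSn addnC ltn_add2r IHn.
by rewrite leq_mul2r fb orbT.
Qed.

Lemma eq_lexnum n (f g : 'I_n -> nat) : f =1 g -> lexnum f = lexnum g.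
Proof.
elim: n f g => //= n IHn f g fg; rewrite fg.
by congr addn; apply: IHn => i.
Qed.

Lemma lexlt_lexnum n (f g : 'I_n -> nat) : (forall i, f i < b) ->
  lexlt f g -> lexnum f < lexnum g.
Proof.
elim: n f g => [|n IHn] f g fb [j [fg lt_j]]; first by have := ltn_ord j.
move: fg lt_j; case: (unliftP ord0 j) => [j'|] -> fg lt_j /=.
  rewrite (fg ord0) // ltn_add2l; apply: IHn => //; exists j'.
  by split=> // i lt_i; apply: fg.
apply: (@leq_trans ((f ord0).+1 * b ^ n)).
  by rewrite mulSn addnC ltn_add2r lexnum_bound.
by apply: leq_trans (leq_addr _ _); rewrite leq_mul2r lt_j orbT.
Qed.

Lemma lex_cases n (f g : 'I_n -> nat) : [\/ f =1 g, lexlt f g | lexlt g f].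
Proof.
have [/forallP fg|] := boolP [forall i, f i == g i].
  by apply: Or31 => i; apply/eqP.
rewrite negb_forall => /existsP[i0 i0P].
case: (@arg_minnP _ i0 (fun i => f i != g i) (@nat_of_ord n) i0P) => j jP jmin.
have eq_below (i : 'I_n) : i < j -> f i = g i.
  by rewrite ltnNge => /negP lt_i; apply/eqP/negPn/negP => /jmin.
move: jP; rewrite neq_ltn => /orP[lt|lt]; [apply: Or32|apply: Or33].
  by exists j.
by exists j; split=> // i /eq_below.
Qed.

Lemma lexnum_inj n (f g : 'I_n -> nat) :
  (forall i, f i < b) -> (forall i, g i < b) -> lexnum f = lexnum g -> f =1 g.
Proof.
move=> fb gb eq_fg.
case: (lex_cases f g) => // /lexlt_lexnum; rewrite eq_fg ltnn.
  by move/(_ fb).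
by move/(_ gb).
Qed.

Lemma lexnum_lt n (f g : 'I_n -> nat) :
  (forall i, f i < b) -> (forall i, g i < b) ->
  lexnum f < lexnum g -> lexlt f g.
Proof.
move=> fb gb lt_fg; case: (lex_cases f g) => // [/eq_lexnum eq_fg|].
  by rewrite eq_fg ltnn in lt_fg.
by move/lexlt_lexnum=> /(_ gb) /ltnW; rewrite leqNgt lt_fg.
Qed.

End LexNumbers.

Lemma ltn_digit B x y x' y' : y < B -> y' < B ->
  (x * B + y < x' * B + y') = (x < x') || ((x == x') && (y < y')).
Proof.
move=> yB y'B; case: (ltngtP x x') => [lt|lt|->] /=; last by rewrite ltn_add2l.
  apply: (@leq_trans (x.+1 * B)); first by rewrite mulSn addnC ltn_add2r.
  by apply: leq_trans (leq_addr _ _); rewrite leq_mul2r lt orbT.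
apply/negbTE; rewrite -leqNgt ltnW //; apply: (@leq_trans (x'.+1 * B)).
  by rewrite mulSn addnC ltn_add2r.
by apply: leq_trans (leq_addr _ _); rewrite leq_mul2r lt orbT.
Qed.

Lemma eqn_digit B x y x' y' : y < B -> y' < B ->
  x * B + y = x' * B + y' -> x = x' /\ y = y'.
Proof.
move=> yB y'B eq_xy; have B0 : 0 < B by apply: leq_ltn_trans yB.
have := congr1 (divn^~ B) eq_xy.
rewrite !divnMDl // !divn_small // !addn0 => xx'.
by split=> //; move: eq_xy; rewrite xx' => /addnI.
Qed.

Section FirstOccurrences.
Variables (A : eqType) (n : nat) (d : 'I_n -> A).

Definition is_new (i : 'I_n) := [forall j : 'I_n, (j < i) ==> (d j != d i)].

Lemma first_occurrence (k : 'I_n) :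
  exists i : 'I_n, [/\ i <= k, is_new i & d i = d k].
Proof.
case: (@arg_minnP _ k (fun i => d i == d k) (@nat_of_ord n) (eqxx _)).
move=> i /eqP di imin.
exists i; split=> //; first exact: imin.
apply/forallP=> j; apply/implyP=> lt_j; apply: contraTneq lt_j => dj.
by rewrite -leqNgt imin // dj di.
Qed.

Lemma is_new_inj (i j : 'I_n) : is_new i -> is_new j -> d i = d j -> i = j.
Proof.
move=> /forallP/(_ j)/implyP ni /forallP/(_ i)/implyP nj dij.
have [lt|lt|/ord_inj//] := ltngtP i j.
  by have := nj lt; rewrite dij eqxx.
by have := ni lt; rewrite dij eqxx.
Qed.

End FirstOccurrences.

(** * Stretching words *)

Section Words.
Variables (FT : finType) (GT : finZmodType).
Local Open Scope ring_scope.

(** (F', G') arises from (F, G) by inserting letters: [st_emb] tells where the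
    old letters go, and [st_f], [st_g] which old letters the two components of
    each letter repeat.  An inserted position repeats earlier letters, its
    column that of a first occurrence of a column and its row that of a
    position which is not such a first occurrence, while the rows inserted
    under one column sum to zero.  The matrices realizing the insertion
    subtract the inserted rows from the row at the first occurrence of their
    column, so the last condition says that this row is restored. *)
Record stretch n p (F : 'I_n -> FT) (G : 'I_n -> GT) (F' : 'I_p -> FT)
   (G' : 'I_p -> GT) := Stretch {
  st_emb : 'I_n -> 'I_p;
  st_f : 'I_p -> 'I_n;
  st_g : 'I_p -> 'I_n;
  st_fK : forall i, st_f (st_emb i) = i;
  st_gK : forall i, st_g (st_emb i) = i;
  st_f_lt : forall (k : 'I_p) (j : 'I_n), (k < st_emb j)%N -> (st_f k < j)%N;
  st_g_lt : forall (k : 'I_p) (j : 'I_n), (k < st_emb j)%N -> (st_g k < j)%N;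
  st_F : forall k, F' k = F (st_f k);
  st_G : forall k, G' k = G (st_g k);
  st_f_new : forall k, k != st_emb (st_f k) -> is_new F (st_f k);
  st_g_old : forall k, k != st_emb (st_f k) -> ~~ is_new F (st_g k);
  st_sum : forall i, \sum_(k | (k != st_emb (st_f k)) && (st_f k == i)) G' k = 0
}.

Section Keys.
Variable b : nat.
Hypothesis FTb : (#|FT| <= b)%N.
Hypothesis GTb : (#|GT| < b)%N.

Definition codeF n (F : 'I_n -> FT) i : nat := enum_rank (F i).
Definition codeG n (G : 'I_n -> GT) i : nat := enum_rank (G i).
(** The rows at first occurrences of columns are masked: they are the ones
    that a stretch modifies, so they are compared only after all others.  The
    successor keeps the mask apart from genuine codes. *)
Definition codeM n (F : 'I_n -> FT) (G : 'I_n -> GT) i : nat :=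
  if is_new F i then 0%N else (codeG G i).+1.

(** Compares, in this order, the index a, the columns, the rows outside first
    occurrences of columns, and all rows. *)
Definition key n (a : nat) (F : 'I_n -> FT) (G : 'I_n -> GT) : nat :=
  (((a * b ^ n + lexnum b (codeF F)) * b ^ n + lexnum b (codeM F G)) * b ^ n
    + lexnum b (codeG G))%N.

Let codeFb n (F : 'I_n -> FT) i : (codeF F i < b)%N.
Proof. by apply: leq_trans FTb; rewrite ltn_ord. Qed.

Let codeGb n (G : 'I_n -> GT) i : (codeG G i < b)%N.
Proof. by apply: ltn_trans GTb; rewrite ltn_ord. Qed.

Let codeMb n (F : 'I_n -> FT) (G : 'I_n -> GT) i : (codeM F G i < b)%N.
Proof.
rewrite /codeM; case: ifP => _; first by apply: leq_ltn_trans GTb.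
by apply: leq_ltn_trans GTb; rewrite ltn_ord.
Qed.

Lemma codeF_inj n (F F' : 'I_n -> FT) i : codeF F i = codeF F' i -> F i = F' i.
Proof. by move/val_inj/enum_rank_inj. Qed.

Lemma codeG_inj n (G G' : 'I_n -> GT) i : codeG G i = codeG G' i -> G i = G' i.
Proof. by move/val_inj/enum_rank_inj. Qed.

Lemma eq_codeM n (F F' : 'I_n -> FT) (G : 'I_n -> GT) :
  F =1 F' -> codeM F G =1 codeM F' G.
Proof.
move=> FF i; rewrite /codeM; suff -> : is_new F i = is_new F' i by [].
by apply: eq_forallb => j; rewrite !FF.
Qed.

Lemma key_inj n a a' (F F' : 'I_n -> FT) (G G' : 'I_n -> GT) :
  key a F G = key a' F' G' -> [/\ a = a', F =1 F' & G =1 G'].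
Proof.
have bF := fun F => lexnum_bound (@codeFb n F).
have bG := fun G => lexnum_bound (@codeGb n G).
have bM := fun F G => lexnum_bound (@codeMb n F G).
case/(eqn_digit (bG _) (bG _)) => /(eqn_digit (bM _ _) (bM _ _))[].
case/(eqn_digit (bF _) (bF _)) => -> eF _ eG; split=> // i.
  by apply: codeF_inj; apply: (lexnum_inj (@codeFb n F) (@codeFb n F') eF).
by apply: codeG_inj; apply: (lexnum_inj (@codeGb n G) (@codeGb n G') eG).
Qed.

(** The first difference of two sequences, at j, becomes a first difference at
    e j, since what is inserted before e j copies letters from before j. *)
Lemma lexlt_stretch n p (f g : 'I_n -> nat) (e : 'I_n -> 'I_p)
    (s : 'I_p -> 'I_n) :
  (forall i, s (e i) = i) ->
  (forall (k : 'I_p) (j : 'I_n), (k < e j)%N -> (s k < j)%N) ->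
  lexlt f g -> lexlt (f \o s) (g \o s).
Proof.
move=> sK s_lt [j [fg lt_j]]; exists (e j); split=> [k /s_lt/fg //|].
by rewrite /= sK.
Qed.

(** Inserted columns repeat earlier ones, hence first occurrences correspond. *)
Lemma is_new_stretch n p (F : 'I_n -> FT) G (F' : 'I_p -> FT) G'
    (S : stretch F G F' G') k :
  is_new F' k = (k == st_emb S (st_f S k)) && is_new F (st_f S k).
Proof.
case: eqP => [->|/eqP nk] /=; last first.
  apply/negP=> /forallP/(_ (st_emb S (st_f S k))); rewrite !(st_F S) st_fK eqxx.
  rewrite implybF -leqNgt leq_eqVlt (inj_eq val_inj) (negPf nk) /=.
  by move/(st_f_lt (s := S)); rewrite ltnn.
rewrite !st_fK; move: (st_f S k) => {k} i.
apply/forallP/forallP=> newF j; apply/implyP=> lt_j.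
  have := newF (st_emb S j); rewrite !(st_F S) !st_fK; move/implyP; apply.
  rewrite ltnNge leq_eqVlt (inj_eq val_inj).
  apply/negP=> /orP[/eqP eij|/(st_f_lt (s := S))].
    by have := lt_j; rewrite -(st_fK S j) -eij st_fK ltnn.
  by rewrite st_fK ltnNge ltnW.
have := newF (st_f S j); rewrite !(st_F S) !st_fK; move/implyP; apply.
exact: st_f_lt lt_j.
Qed.

Lemma codeM_stretch n p (F : 'I_n -> FT) G (F' : 'I_p -> FT) G'
    (S : stretch F G F' G') (G1 : 'I_n -> GT) (G1' : 'I_p -> GT) :
  (forall k, ~~ is_new F' k -> G1' k = G1 (st_g S k)) ->
  codeM F' G1' =1 codeM F G1 \o st_g S.
Proof.
move=> G1E k; rewrite /codeM /= /codeG; have := G1E k.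
rewrite (is_new_stretch S k); have [kE|nk] /= := eqVneq k (st_emb S (st_f S k)).
  by rewrite kE !st_fK !st_gK; case: ifP => //= _ ->.
by move=> ->; rewrite ?(negPf (st_g_old nk)).
Qed.

(** (F1', G1') is the image of an arbitrary word (F1, G1) under the morphism
    built from S.  If the columns differ from F, only columns matter and
    [lexlt_stretch] applies.  If they agree, masked rows are compared, and
    these are merely copied.  If masked rows agree too, then the inserted rows
    are those of (F', G'), so they sum to zero under each column and the
    remaining rows are copied unchanged. *)
Lemma key_stretch n p (F : 'I_n -> FT) G (F' : 'I_p -> FT) G'
    (S : stretch F G F' G') a a1 F1 G1 (F1' : 'I_p -> FT) (G1' : 'I_p -> GT) :
  (forall k, F1' k = F1 (st_f S k)) ->
  (forall k, G1' k = if k == st_emb S (st_f S k) then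
       G1 (st_f S k) -
       \sum_(k' | (k' != st_emb S (st_f S k')) && (st_f S k' == st_f S k))
         G1 (st_g S k')
     else G1 (st_g S k)) ->
  (key a1 F1 G1 < key a F G)%N -> (key a1 F1' G1' < key a F' G')%N.
Proof.
move=> F1E G1E.
have bF q (H : 'I_q -> FT) := lexnum_bound (@codeFb q H).
have bG q (H : 'I_q -> GT) := lexnum_bound (@codeGb q H).
have bM q (H : 'I_q -> FT) (K : 'I_q -> GT) := lexnum_bound (@codeMb q H K).
have F1F' : F1 =1 F -> F1' =1 F' by move=> F1F k; rewrite F1E F1F (st_F S).
have M1M : F1 =1 F -> codeM F1' G1' =1 codeM F1 G1 \o st_g S.
  move=> F1F k; rewrite (eq_codeM _ (F1F' F1F)) /= (eq_codeM _ F1F).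
  apply: codeM_stretch => {}k; rewrite (is_new_stretch S) G1E.
  case: eqP => //= kE nnew; rewrite big_pred0 => [|k'].
    by rewrite subr0 kE st_fK st_gK.
  apply/negP=> /andP[/(st_f_new (s := S)) + /eqP k'E].
  by rewrite k'E (negPf nnew).
have MM : codeM F' G' =1 codeM F G \o st_g S.
  by apply: codeM_stretch => k _; apply: (st_G S).
rewrite /key !ltn_digit //; case/orP=> [/orP[/orP[->//|/andP[/eqP -> ltF]]|]|].
- suff ltF' : (lexnum b (codeF F1') < lexnum b (codeF F'))%N.
    by rewrite eqxx ltF' orbT.
  apply: lexlt_lexnum => //.
  apply: eq_lexlt (lexlt_stretch (st_fK S) (st_f_lt (s := S))
    (lexnum_lt (codeFb _) (codeFb _) ltF)) => k; rewrite /codeF /=.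
    by rewrite F1E.
  by rewrite (st_F S).
- case/andP=> /eqP/(eqn_digit (bF _ _) (bF _ _))[-> eqF] ltM.
  have F1F i : F1 i = F i.
    by apply/codeF_inj/(lexnum_inj (codeFb _) (codeFb _) eqF).
  have -> : lexnum b (codeF F1') = lexnum b (codeF F').
    by apply: eq_lexnum => k; rewrite /codeF (F1F' F1F).
  rewrite !eqxx !ltnn /=; apply/orP; left.
  apply: lexlt_lexnum => //.
  apply: eq_lexlt (lexlt_stretch (st_gK S) (st_g_lt (s := S))
    (lexnum_lt (codeMb _ _) (codeMb _ _) ltM)) => k; first by rewrite M1M.
  by rewrite MM.
case/andP=> /eqP/(eqn_digit (bM _ _ _) (bM _ _ _))[+ eqM] ltG.
case/(eqn_digit (bF _ _) (bF _ _)) => -> eqF.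
have F1F i : F1 i = F i.
  by apply/codeF_inj/(lexnum_inj (codeFb _) (codeFb _) eqF).
have G1G i : ~~ is_new F i -> G1 i = G i.
  move=> nnew; apply: codeG_inj.
  have := lexnum_inj (codeMb _ _) (codeMb _ _) eqM i.
  by rewrite (eq_codeM _ F1F) /codeM (negPf nnew) => -[].
have G1g k : G1' k = G1 (st_g S k).
  rewrite G1E; case: eqP => // kE; rewrite [X in _ - X](_ : _ = 0).
    by rewrite subr0 kE st_fK st_gK.
  rewrite -[RHS](st_sum S (st_f S k)); apply: eq_bigr => k' /andP[nk' _].
  by rewrite G1G ?(st_g_old nk') // (st_G S).
have -> : lexnum b (codeF F1') = lexnum b (codeF F').
  by apply: eq_lexnum => k; rewrite /codeF (F1F' F1F).
have -> : lexnum b (codeM F1' G1') = lexnum b (codeM F' G').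
  apply: eq_lexnum => k; rewrite M1M // MM /=.
  exact: (lexnum_inj (codeMb _ _) (codeMb _ _) eqM).
rewrite !eqxx /=; apply/orP; right; apply: lexlt_lexnum => //.
apply: eq_lexlt (lexlt_stretch (st_gK S) (st_g_lt (s := S))
  (lexnum_lt (codeGb _) (codeGb _) ltG)) => k; rewrite /codeG /=.
  by rewrite G1g.
by rewrite (st_G S).
Qed.

End Keys.
Definition letter n (F : 'I_n -> FT) (G : 'I_n -> GT) i :=
  (F i, G i, is_new F i).

(** Letters decorated so that an embedding of decorated words that reaches all
    their letters preserves first occurrences, both of columns and of
    letters. *)
Definition flagged n (F : 'I_n -> FT) (G : 'I_n -> GT) i :=
  (letter F G i, is_new (letter F G) i).

Definition fiber_sum n (F : 'I_n -> FT) (G : 'I_n -> GT) : {ffun FT -> GT} :=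
  [ffun f => \sum_(i | F i == f) G i].

(** An inserted position k repeats the column at the first occurrence of its
    column and the row at the first occurrence of its letter.  Both first
    occurrences lie in the image of e, because the flags identify them and the
    two words have the same decorated letters.  Equality of the sums over
    columns makes the inserted rows cancel. *)
Lemma stretch_of_embedding n p (F : 'I_n -> FT) (G : 'I_n -> GT)
    (F' : 'I_p -> FT) (G' : 'I_p -> GT) (e : 'I_n -> 'I_p) :
  (forall i, flagged F' G' (e i) = flagged F G i) ->
  (forall i j : 'I_n, (i < j)%N -> (e i < e j)%N) ->
  (forall k, exists i, flagged F G i = flagged F' G' k) ->
  fiber_sum F' G' = fiber_sum F G -> inhabited (stretch F G F' G').
Proof.
move=> eE e_mono e_onto sumE.
have e_lt i j : (e i < e j)%N -> (i < j)%N.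
  case: (ltngtP i j) => [//|/e_mono lt /(ltn_trans lt)|/ord_inj ->];
  by rewrite ltnn.
have e_inj : injective e.
  move=> i j eij; apply: ord_inj; case: (ltngtP i j) => // /e_mono;
  by rewrite eij ltnn.
have first_F (k : 'I_p) :
    exists i, [/\ (e i <= k)%N, is_new F i, F i = F' k & is_new F' (e i)].
  have [k0 [le_k0 new_k0 Fk0]] := first_occurrence F' k.
  have [i iE] := e_onto k0; have [F'e _ newF'e _] := etrans (eE i) iE.
  case: iE => Fi _ newF _.
  have ek0 : e i = k0 by apply: is_new_inj F'e; rewrite ?newF'e.
  by exists i; rewrite newF'e newF ek0 new_k0 Fi.
have first_letter (k : 'I_p) :
    exists i, (e i <= k)%N /\ letter F G i = letter F' G' k.
  have [k0 [le_k0 new_k0 lk0]] := first_occurrence (letter F' G') k.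
  have [i iE] := e_onto k0.
  have /pair_equal_spec[l'e new'e] := etrans (eE i) iE.
  case/pair_equal_spec: iE => li _; have ek0 : e i = k0.
    by apply: is_new_inj l'e; rewrite ?new'e.
  by exists i; rewrite ek0 li.
(* For k in the image of e both indices are the preimage of k; otherwise they
   are the positions whose column and row are repeated at k. *)
pose P (k : 'I_p) (ij : 'I_n * 'I_n) := (k = e ij.1 /\ ij.2 = ij.1) \/
  [/\ forall i, k <> e i, (e ij.1 < k)%N /\ (e ij.2 < k)%N,
    F ij.1 = F' k /\ is_new F ij.1, G ij.2 = G' k & ~~ is_new F ij.2].
have /fin_all_exists[s sP] : forall k, exists ij, P k ij.
  move=> k; have [/existsP[i /eqP ki]|] := boolP [exists i, k == e i].
    by exists (i, i); left.
  rewrite negb_exists => /forallP nk.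
  have lt_k i : (e i <= k)%N -> (e i < k)%N.
    by rewrite leq_eqVlt (inj_eq val_inj) eq_sym (negPf (nk i)).
  have [i [/lt_k ik newi Fi newei]] := first_F k.
  have [j [/lt_k jk [_ Gj newj]]] := first_letter k.
  exists (i, j); right; split=> //= [i' /eqP|]; first exact/negP.
  rewrite newj; apply/negP=> newk.
  suff /eqP: k = e i by rewrite (negPf (nk i)).
  apply: (is_new_inj newk newei); rewrite -Fi.
  by have [->] := eE i.
have s_e i : s (e i) = (i, i).
  case: (sP (e i)) => [[/e_inj + ]|[/(_ i) []//]].
  by case: (s (e i)) => a b /= -> ->.
have s_lt (k : 'I_p) (j : 'I_n) :
    (k < e j)%N -> ((s k).1 < j)%N && ((s k).2 < j)%N.
  case: (sP k) => [[kE ->]|[_ [lt1 lt2] _ _ _]] lt_k.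
    by rewrite andbb; apply: e_lt; rewrite -kE.
  by rewrite !e_lt // (ltn_trans _ lt_k).
have s_im k : k != e (s k).1 -> [/\ F (s k).1 = F' k, is_new F (s k).1,
    G (s k).2 = G' k & ~~ is_new F (s k).2].
  by case: (sP k) => [[/eqP-> _]|[_ _ [-> ->] -> ->]].
have F'E k : F' k = F (s k).1.
  have [{1}->|/s_im[-> //]] := eqVneq k (e (s k).1).
  by have [-> ] := eE (s k).1.
split; exists e (fun k => (s k).1) (fun k => (s k).2) => //.
- by move=> i; rewrite s_e.
- by move=> i; rewrite s_e.
- by move=> k j /s_lt/andP[].
- by move=> k j /s_lt/andP[].
- move=> k; case: (sP k) => [[kE ->]|[_ _ _ -> //]].
  by rewrite {1}kE; have [_ ->] := eE (s k).1.
- by move=> k /s_im[].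
- by move=> k /s_im[].
move=> i; have [newi|nnewi] := boolP (is_new F i); last first.
  rewrite big_pred0 // => k; apply/negP=> /andP[/s_im[_ + _ _] /eqP ki].
  by rewrite ki (negPf nnewi).
have := congr1 (fun h : {ffun FT -> GT} => h (F i)) sumE; rewrite !ffunE.
rewrite (bigID (fun k => k == e (s k).1)) /=.
rewrite (reindex_onto e (fun k => (s k).1)) /=; last first.
  by move=> k /andP[_ /eqP <-].
rewrite (eq_bigl (fun j => F j == F i)); last first.
  by move=> j; rewrite s_e /= !eqxx !andbT; have [->] := eE j.
rewrite (eq_bigr (fun j => G j)); last by move=> j _; have [_ ->] := eE j.
rewrite -[RHS]addr0 => /addrI sum0; rewrite -[RHS]sum0; apply: eq_bigl => k.
have [//|/s_im[Fk newk _ _]] := eqVneq k (e (s k).1); first by rewrite andbF.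
rewrite andbT /= -Fk; apply/eqP/eqP => [-> //|].
exact: is_new_inj.
Qed.

(** Higman's lemma for decorated words, combined with two invariants ranging
    over finite sets: the set of decorated letters and the sums of rows over
    the positions of each column. *)
Theorem stretch_wqo : wqo (fun _ => True)
  (fun x y : {n : nat & (('I_n -> FT) * ('I_n -> GT))%type} =>
    inhabited (stretch (tagged x).1 (tagged x).2 (tagged y).1 (tagged y).2)).
Proof.
pose L := ((FT * GT * bool) * bool)%type.
pose X := {n : nat & (('I_n -> FT) * ('I_n -> GT))%type}.
pose w (x : X) : seq L := codom (flagged (tagged x).1 (tagged x).2).
pose a (x : X) : {set L} := [set l in w x].
pose t (x : X) := fiber_sum (tagged x).1 (tagged x).2.
have ww := wqo_preim (f := w) (@higman L).
have wa := wqo_preim (f := a) (@wqo_fin {set L}).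
have wt := wqo_preim (f := t) (@wqo_fin {ffun FT -> GT}).
apply: wqo_sub (wqo_and (wqo_and ww wa) wt) => // -[n [F G]] [p [F' G']] _ _ /=.
case=> -[/codom_embedding[e [eE e_mono]] /setP aE tE].
apply: (stretch_of_embedding eE e_mono) => // k.
have := aE (flagged F' G' k); rewrite !inE [in RHS]/w codom_f => /codomP[i iE].
by exists i.
Qed.

End Words.

Local Open Scope ring_scope.

(** * Words of morphisms modulo N *)

Lemma intr_Zp_eq0 N (x : int) : (1 < N)%N -> (x%:~R : 'Z_N) = 0 -> (N %| x)%Z.
Proof.
move=> N1 x0; have N0 : N%:Z != 0 by case: N N1 {x0}.
apply/dvdz_mod0P; move: x0; rewrite {1}(divz_eq x N) rmorphD rmorphM /=.
rewrite -[N%:~R]/(N%:R) pchar_Zp // mulr0 add0r.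
have N_gt0 : 0 < N%:Z by rewrite ltz_nat ltnW.
move: (modz_ge0 x N0) (ltz_pmod x N_gt0); case: (x %% N)%Z => // r _ lt_rN.
move/(congr1 val); rewrite /= -[r%:~R]/(r%:R) val_Zp_nat // modn_small //.
by move=> ->.
Qed.

Lemma map_mx_congr N m n (A A' : 'M[int]_(m, n)) : (1 < N)%N ->
  map_mx (intr : int -> 'Z_N) A = map_mx intr A' ->
  exists C, A = A' + N%:Z *: C.
Proof.
move=> N1 eqA; exists (\matrix_(i, j) ((A i j - A' i j) %/ N)%Z).
apply/matrixP=> i j; rewrite !mxE mulrC divzK ?subrKC //; last first.
  apply: (intr_Zp_eq0 N1); rewrite rmorphB /=.
  by have /matrixP/(_ i j) := eqA; rewrite !mxE => ->; rewrite subrr.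
Qed.

Section StretchMatrix.
Variables (n p : nat) (e : 'I_n -> 'I_p) (s t : 'I_p -> 'I_n).
Hypotheses (sK : forall i, s (e i) = i).

Definition stretch_inj : 'M[int]_(n, p) := \matrix_(i, k) (s k == i)%:R.

(** The row at e i is corrected by the inserted rows so that the two matrices
    form a split pair. *)
Definition stretch_ret : 'M[int]_(p, n) := \matrix_(k, i)
  if k == e (s k) then
    (s k == i)%:R - \sum_(k' | (k' != e (s k')) && (s k' == s k)) (t k' == i)%:R
  else (t k == i)%:R.

Lemma mul_stretch_inj m (A : 'M[int]_(m, n)) a k :
  (A *m stretch_inj) a k = A a (s k).
Proof.
rewrite mxE (bigD1 (s k)) //= big1 => [|i ik].
  by rewrite mxE eqxx mulr1 addr0.
by rewrite mxE eq_sym (negPf ik) mulr0.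
Qed.

Lemma sum_delta_mul m (B : 'M[int]_(n, m)) i c :
  \sum_j (i == j)%:R * B j c = B i c.
Proof.
rewrite (bigD1 i) //= big1 => [|j ij]; first by rewrite eqxx mul1r addr0.
by rewrite eq_sym (negPf ij) mul0r.
Qed.

Lemma mul_stretch_ret m (B : 'M[int]_(n, m)) k c :
  (stretch_ret *m B) k c = if k == e (s k) then
    B (s k) c - \sum_(k' | (k' != e (s k')) && (s k' == s k)) B (t k') c
  else B (t k) c.
Proof.
rewrite mxE; case: ifP => kE.
  under eq_bigr => i _ do rewrite mxE kE mulrBl mulr_suml.
  rewrite sumrB sum_delta_mul exchange_big /=; congr (_ - _).
  by apply: eq_bigr => k' _; rewrite sum_delta_mul.
by under eq_bigr => i _ do rewrite mxE kE; rewrite sum_delta_mul.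
Qed.

Lemma stretch_injK : stretch_inj *m stretch_ret = 1%:M.
Proof.
apply/matrixP=> i j; rewrite mxE.
transitivity (\sum_(k | s k == i) stretch_ret k j).
  rewrite [RHS]big_mkcond; apply: eq_bigr => k _; rewrite mxE.
  by case: ifP; rewrite ?mul1r ?mul0r.
rewrite (bigID (fun k => k == e (s k))) /=.
rewrite (big_pred1 (e i)) => [|k]; last first.
  by apply/andP/eqP => [[/eqP <- /eqP] | ->]; rewrite ?sK ?eqxx.
rewrite !mxE sK eqxx -[RHS]addr0 -addrA; congr (_ + _).
rewrite addrC; apply/eqP; rewrite subr_eq0; apply/eqP.
apply: eq_big => [k|k /andP[_ /negPf kE]]; first by rewrite andbC.
by rewrite mxE kE.
Qed.

End StretchMatrix.

Section CongruenceGroebner.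
Variables (R : comPzRingType) (V : VICmodule R) (U : VICsubmodule V).
Hypothesis hN : noetherian R.
Variables (X : VICobj) (q : nat) (v : 'I_q -> V X) (N : nat).
Variable big : VICobj -> Prop.

Definition modN m n (A : 'M[int]_(m, n)) : 'M['Z_N]_(m, n) := map_mx intr A.

Hypothesis v_cong : forall i Z (f f' : VIChom X Z), big Z ->
  modN (injmx f) = modN (injmx f') -> modN (retmx f) = modN (retmx f') ->
  vic_map V f (v i) = vic_map V f' (v i).
Hypothesis v_gen : forall Z (y : V Z), big Z ->
  lspan (fun x => exists i (f : VIChom X Z), x = vic_map V f (v i)) y.

Let FT : finType := 'cV['Z_N]_(dim X).
Let GT : finZmodType := 'rV['Z_N]_(dim X).

Definition colmod Z (f : VIChom X Z) (k : 'I_(dim Z)) : FT :=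
  col k (modN (injmx f)).
Definition rowmod Z (f : VIChom X Z) (k : 'I_(dim Z)) : GT :=
  row k (modN (retmx f)).

Lemma colmod_inj Z (f f' : VIChom X Z) :
  colmod f =1 colmod f' -> modN (injmx f) = modN (injmx f').
Proof.
move=> ff; apply/matrixP=> a k; have /colP/(_ a) := ff k.
by rewrite !mxE.
Qed.

Lemma rowmod_inj Z (f f' : VIChom X Z) :
  rowmod f =1 rowmod f' -> modN (retmx f) = modN (retmx f').
Proof. by move=> ff; apply/row_matrixP. Qed.

Let b := (#|FT| + #|GT|).+1.
Let FTb : (#|FT| <= b)%N. Proof. by rewrite leqW ?leq_addr. Qed.
Let GTb : (#|GT| < b)%N. Proof. by rewrite ltnS leq_addl. Qed.

Let word Z := ('I_q * VIChom X Z)%type.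
Let ev Z (w : word Z) : V Z := vic_map V w.2 (v w.1).
Let rank Z (w : word Z) : nat := key b w.1 (colmod w.2) (rowmod w.2).
Let le Y Z (w : word Y) (w' : word Z) := w.1 = w'.1 /\
  inhabited (stretch (colmod w.2) (rowmod w.2) (colmod w'.2) (rowmod w'.2)).

(** The abstract theorem applied to words of morphisms from X, a word standing
    for an integral morphism that is ranked by its class modulo N; a stretch of
    words is realized by the integral matrices above. *)
Lemma congruence_generation : exists s : seq {Z : VICobj & V Z},
  (forall t, List.In t s -> U (tag t) (tagged t)) /\
  forall Z (y : V Z), big Z -> U Z y -> vspan s y.
Proof.
apply: (@groebner_generation R V U hN big word rank ev le).
- move=> Z y bZ; apply: lspan_mono (v_gen _ bZ) => _ [i [f ->]].
  by apply: lspan_sub; exists (i, f).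
- move=> Z [i f] [i' f'] bZ /(key_inj FTb GTb)[/= /ord_inj -> ff gg].
  by apply: v_cong => //; [exact: colmod_inj | exact: rowmod_inj].
- move=> Y Z [i f] [i' f'] bY bZ [/= <- [S]].
  pose h := mxhom (stretch_injK (st_g S) (st_fK S)).
  have colh (f1 : VIChom X Y) k :
      colmod (vic_comp h f1) k = colmod f1 (st_f S k).
    apply/colP=> a; rewrite !mxE injmx_comp.
    by congr (_%:~R); apply: mul_stretch_inj.
  have rowh (f1 : VIChom X Y) k : rowmod (vic_comp h f1) k =
     if k == st_emb S (st_f S k) then rowmod f1 (st_f S k) -
       \sum_(k' | (k' != st_emb S (st_f S k')) && (st_f S k' == st_f S k))
         rowmod f1 (st_g S k') else rowmod f1 (st_g S k).
    apply/rowP=> c; rewrite !mxE retmx_comp mul_stretch_ret.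
    case: ifP => _; rewrite !mxE // rmorphB rmorph_sum summxE; congr (_ - _).
    by apply: eq_bigr => k' _; rewrite !mxE.
  exists h; split.
    rewrite /ev /= -vic_map_comp; apply: v_cong => //.
      by apply: colmod_inj => k; rewrite colh (st_F S).
    apply: rowmod_inj => k; rewrite rowh (st_G S); case: eqP => // kE.
    rewrite [X in _ - X](_ : _ = 0).
      by rewrite subr0 kE st_gK st_fK.
    rewrite -[RHS](st_sum S (st_f S k)); apply: eq_bigr => k' _.
    by rewrite (st_G S).
  move=> [i1 f1] lt_f1.
  exists (i1, vic_comp h f1); last by rewrite /ev vic_map_comp.
  exact: (key_stretch FTb GTb (S := S) (colh f1) (rowh f1) lt_f1).
move=> x _.
pose wd (w : {Z & word Z}) : {n & (('I_n -> FT) * ('I_n -> GT))%type} :=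
  Tagged (fun n => (('I_n -> FT) * ('I_n -> GT))%type)
    (colmod (tagged w).2, rowmod (tagged w).2).
pose ix (w : {Z & word Z}) := (tagged w).1.
have wq := wqo_and (wqo_preim (f := ix) (@wqo_fin 'I_q))
                   (wqo_preim (f := wd) (@stretch_wqo FT GT)).
exact: (wq x).
Qed.

End CongruenceGroebner.

(** * All ranks together *)

Section Assembly.
Variables (R : comPzRingType) (V : VICmodule R).
Implicit Types X Y Z : VICobj.

Variable U : VICsubmodule V.
Hypotheses (hN : noetherian R) (hpfg : vic_pointwise_fg V).

(** All objects of a given rank are isomorphic, so the generators of one term
    serve as words for all of them, and words with the same index are
    comparable through the isomorphisms. *)
Lemma fixed_rank_generation X : exists s : seq {Z : VICobj & V Z},
  (forall t, List.In t s -> U (tag t) (tagged t)) /\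
  forall Z (y : V Z), dim Z = dim X -> U Z y -> vspan s y.
Proof.
have [q [v [_ vP]]] := pointwise_fg hpfg X.
apply: (@groebner_generation R V U hN (fun Z => dim Z = dim X)
  (fun Z => ('I_q * (dim X = dim Z))%type) (fun Z w => w.1 : nat)
  (fun Z w => vic_map V (iso_hom w.2) (v w.1))
  (fun Y Z w w' => w.1 = w'.1)).
- move=> Z y eZ.
  have -> : y = vic_map V (iso_hom (esym eZ)) (vic_map V (iso_hom eZ) y).
    by rewrite -vic_map_comp iso_homK vic_map_id.
  have [c ->] := vP (vic_map V (iso_hom eZ) y) I; rewrite linear_sum.
  apply: (submodule_sum (lspan_submodule _)) => i.
  rewrite linearZ; apply: (submoduleZ (lspan_submodule _)).
  by apply: lspan_sub; exists (i, esym eZ).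
- move=> Z [i e] [i' e'] _ /= /ord_inj ->; congr (vic_map V (iso_hom _) _).
  exact: eq_irrelevance.
- move=> Y Z [i e] [i' e'] eY eZ /= <-; exists (iso_hom (etrans eY (esym eZ))).
  have comp e1 :
      vic_comp (iso_hom (etrans eY (esym eZ))) (iso_hom e1) = iso_hom e'.
    exact: iso_hom_comp.
  split; first by rewrite -vic_map_comp comp.
  by move=> [u e1] lt_u; exists (u, e'); rewrite // -vic_map_comp comp.
pose ix (w : {Z : VICobj & ('I_q * (dim X = dim Z))%type}) := (tagged w).1.
by move=> x _; have := wqo_preim (f := ix) (@wqo_fin 'I_q) => /(_ x); apply.
Qed.

Lemma bounded_rank_generation n : exists s : seq {Z : VICobj & V Z},
  (forall t, List.In t s -> U (tag t) (tagged t)) /\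
  forall Z (y : V Z), (dim Z < n)%N -> U Z y -> vspan s y.
Proof.
elim: n => [|n [s [sU sP]]]; first by exists [::].
have [[X Xn]|no] := classic (exists X : VICobj, dim X = n); last first.
  exists s; split=> // Z y; rewrite ltnS leq_eqVlt.
  by case/orP=> [/eqP Zn|]; [case: no; exists Z | exact: sP].
have [s' [s'U s'P]] := fixed_rank_generation X.
exists (s ++ s')%list; split=> [t /(List.in_app_or s)[/sU|/s'U] //|Z y].
rewrite ltnS leq_eqVlt => /orP[/eqP Zn|lt_Z] Uy.
  apply: vspan_mono (s'P _ _ _ Uy); last by rewrite Zn Xn.
  by move=> t ts; apply: List.in_or_app; right.
apply: vspan_mono (sP _ _ lt_Z Uy) => t ts.
by apply: List.in_or_app; left.
Qed.

Lemma vic_combination_submodule k (X : 'I_k -> VICobj)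
    (v : forall j, V (X j)) Y :
  is_submodule (@vic_combination R V k X v Y).
Proof.
split=> [|a x y [s ->] [s' ->]]; first by exists [::]; rewrite big_nil.
pose sc (t : {j : 'I_k & (R * VIChom (X j) Y)%type}) :
    {j : 'I_k & (R * VIChom (X j) Y)%type} :=
  Tagged (fun j => (R * VIChom (X j) Y)%type) (a * (tagged t).1, (tagged t).2).
exists ([seq sc t | t <- s] ++ s'); rewrite big_cat big_map scaler_sumr.
by congr (_ + _); apply: eq_bigr => t _; rewrite scalerA.
Qed.

Lemma list_family (T : Type) (s : seq T) : exists k (E : 'I_k -> T),
  (forall j, List.In (E j) s) /\ forall t, List.In t s -> exists j, E j = t.
Proof.
elim: s => [|a s [k [E [Es sE]]]].
  have E (j : 'I_0) : T by case: j.
  by exists 0%N, E; split=> // -[].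
exists k.+1, (fun j => if unlift ord0 j is Some j' then E j' else a).
split=> [j|t [<-|/sE[j <-]]].
- by case: unliftP => [j'|] _; [right; apply: Es | left].
- by exists ord0; rewrite unlift_none.
by exists (lift ord0 j); rewrite liftK.
Qed.

Lemma vspan_finitely_generated (s : seq {Z : VICobj & V Z}) :
  (forall t, List.In t s -> U (tag t) (tagged t)) ->
  (forall Z (y : V Z), U Z y -> vspan s y) -> vsub_finitely_generated U.
Proof.
move=> sU sP; have [k [E [Es sE]]] := list_family s.
exists k, (fun j => tag (E j)), (fun j => tagged (E j)); split=> [j|Y y /sP].
  exact: sU (Es j).
apply; first exact: vic_combination_submodule.
move=> _ [t [f [/sE[j jt] ->]]]; case: t / jt f => f.
exists [:: Tagged (fun j => (R * VIChom (tag (E j)) Y)%type) (1, f)].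
by rewrite big_seq1 scale1r.
Qed.

End Assembly.

(** Generators in several objects can be replaced by module generators of the
    term at one object of rank at least theirs, since morphisms to large
    objects factor through it. *)
Lemma single_object_generation (R : comPzRingType) (V : VICmodule R) :
  vic_finitely_generated V -> vic_pointwise_fg V ->
  exists (X : VICobj) (q : nat) (v : 'I_q -> V X), forall Z (y : V Z),
    (dim X <= dim Z)%N ->
    lspan (fun x => exists i (f : VIChom X Z), x = vic_map V f (v i)) y.
Proof.
move=> [k [Y [w [_ wP]]]] hpfg.
(* The maximum with 3 covers an empty family of generators. *)
have m_gt2 : (2 < maxn 3 (\max_j dim (Y j)))%N by rewrite leq_max.
pose X := vic_std m_gt2; have [q [v [_ vP]]] := pointwise_fg hpfg X.
exists X, q, v => Z y leXZ; have [s ->] := wP Z y I.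
apply: (submodule_sum (lspan_submodule _)) => -[j [a g]] /=.
apply: (submoduleZ (lspan_submodule _)).
have leYX : (dim (Y j) <= dim X)%N.
  by rewrite dim_std leq_max (leq_bigmax j) orbT.
have [|f [h ->]] := @vic_factor (Y j) X Z g; first by rewrite leYX leXZ.
rewrite vic_map_comp; have [c ->] := vP (vic_map V h (w j)) I.
rewrite linear_sum.
apply: (submodule_sum (lspan_submodule _)) => i.
rewrite linearZ; apply: (submoduleZ (lspan_submodule _)).
by apply: lspan_sub; exists i, f.
Qed.

Theorem corollary4p6 (R : comPzRingType) (hSL : SL_finite R)
    (hN : noetherian R) (V : VICmodule R)
    (hfg : vic_finitely_generated V) (hpfg : vic_pointwise_fg V)
    (U : VICsubmodule V) : vsub_finitely_generated U.
Proof.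
have [X [q [v v_gen]]] := single_object_generation hfg hpfg.
have /fin_all_exists[N NP] :=
  fun i : 'I_q => act_through_congruence_class hpfg hSL (v i).
(* The factor 2 ensures 1 < M, so that the residue ring is not degenerate. *)
pose M := (2 * \prod_i N i)%N.
have M_gt1 : (1 < M)%N.
  rewrite (@leq_trans (2 * 1)) // leq_mul2l /= prodn_gt0 // => i.
  by case: (NP i).
pose big (Z : VICobj) : Prop := (dim X + (dim X + dim X) <= dim Z)%N.
have [||s [sU sP]] := @congruence_generation R V U hN X q v M big.
- move=> i Z f f' bZ /(map_mx_congr M_gt1)[C CE] /(map_mx_congr M_gt1)[D DE].
  have NM : M%:Z = (N i)%:Z * (2 * \prod_(j | j != i) N j)%N%:Z.
    by rewrite -PoszM /M (bigD1 i) //= mulnCA.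
  have [_ v_cong] := NP i; apply: v_cong => //.
    by exists ((2 * \prod_(j | j != i) N j)%N%:Z *: C); rewrite scalerA -NM.
  by exists ((2 * \prod_(j | j != i) N j)%N%:Z *: D); rewrite scalerA -NM.
- move=> Z y bZ; apply: v_gen; apply: leq_trans bZ; exact: leq_addr.
have [s' [s'U s'P]] :=
  bounded_rank_generation U hN hpfg (dim X + (dim X + dim X)).
apply: (@vspan_finitely_generated _ _ _ (s ++ s')).
  by move=> t /(List.in_app_or s)[/sU|/s'U].
move=> Z y Uy; have [bZ|lt_Z] := leqP (dim X + (dim X + dim X)) (dim Z).
  apply: vspan_mono (sP _ _ bZ Uy) => t ts.
  by apply: List.in_or_app; left.
apply: vspan_mono (s'P _ _ lt_Z Uy) => t ts.
by apply: List.in_or_app; right.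
Qed.
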